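(* Let $\mathcal M=(M,<,+,\cdot,\ldots)$ be an o-minimal expansion of a real closed field. Let $G$ be a definable group (with its definable manifold topology), let $V$ be a definable set and let $\alpha\colon G\times V\to V$ be a definable transitive action. Let $\tau$ be a topology on $V$ such that $(V,\tau)$ is a definable manifold and $\alpha$ is continuous. Let $v\in V$. Then the continuous map $\gamma\colon G\to(V,\tau)$, $\gamma(g)=\alpha(g,v)$, is an open map.
   Context: ''Definable'' means first-order definable in $\mathcal M$ with parameters. A definable manifold of dimension $n$ is a definable set with a topology admitting a finite cover by definable open sets definably homeomorphic to open subsets of $M^n$. A definable group is a definable set with a definable group operation; its definable manifold topology is the unique topology making it a topological group and a definable manifold of dimension $\dim G$. Such a topology $\tau$ on $V$ as in the statement exists for every definable transitive action. *)

(* Defs.v *)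
From HB Require Import structures.
From mathcomp Require Import all_boot all_order all_algebra.
From mathcomp Require Import boolp classical_sets.
Set Implicit Arguments. Unset Strict Implicit. Unset Printing Implicit Defensive.
Import Order.TTheory GRing.Theory Num.Theory.
Local Open Scope classical_set_scope.
Local Open Scope ring_scope.

Definition eucl_open (R : rcfType) (n : nat) (U : set 'rV[R]_n) : Prop :=
  forall x, U x -> exists e : R, 0 < e /\
    forall y : 'rV[R]_n, (forall i, `|y 0 i - x 0 i| < e) -> U y.

Definition point_or_interval (R : rcfType) (I : set R) : Prop :=
  (exists a, I = [set a]) \/
  (exists a b, I = [set x | a < x < b]) \/
  (exists a, I = [set x | a < x]) \/
  (exists b, I = [set x | x < b]) \/
  I = setT.

(** An o-minimal structure on the ordered field R expanding (R,<,+,.), with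
    all parameters (van den Dries' axiomatization of the family of definable
    sets): D n is the collection of definable subsets of M^n. *)
Record ominimal_field_structure (R : rcfType) (D : forall n, set (set 'rV[R]_n))
  : Prop := {
  om_setT : forall n, D n setT;
  om_setC : forall n A, D n A -> D n (~` A);
  om_setU : forall n A B, D n A -> D n B -> D n (A `|` B);
  om_prod : forall n k (A : set 'rV[R]_n) (B : set 'rV[R]_k), D n A -> D k B ->
      D (n + k)%N [set z | exists x y, A x /\ B y /\ z = row_mx x y];
  om_proj : forall n (A : set 'rV[R]_(n + 1)), D (n + 1)%N A ->
      D n [set x | exists y : 'rV[R]_1, A (row_mx x y)];
  om_diag : forall n (i j : 'I_n), D n [set x | x 0 i = x 0 j];
  om_point : forall a : R, D 1%N [set x | x 0 0 = a];
  om_lt : D 2%N [set x | x 0 (inord 0) < x 0 (inord 1)];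
  om_add : D 3%N [set x | x 0 (inord 0) + x 0 (inord 1) = x 0 (inord 2)];
  om_mul : D 3%N [set x | x 0 (inord 0) * x 0 (inord 1) = x 0 (inord 2)];
  om_omin : forall A : set 'rV[R]_1, D 1%N A ->
      exists (N : nat) (I : 'I_N -> set R),
        (forall i, point_or_interval (I i)) /\
        A = [set x | exists i, I i (x 0 0)]
}.

Definition def_fun (R : rcfType) (D : forall n, set (set 'rV[R]_n)) (n k : nat)
  (A : set 'rV[R]_n) (f : 'rV[R]_n -> 'rV[R]_k) : Prop :=
  D (n + k)%N [set z | exists x, A x /\ z = row_mx x (f x)].

Definition coord_proj (R : rcfType) (n k : nat) (s : 'I_k -> 'I_n)
  (x : 'rV[R]_n) : 'rV[R]_k := \row_i x 0 (s i).

Definition dim_ge (R : rcfType) (n : nat) (A : set 'rV[R]_n) (k : nat) : Prop :=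
  exists s : 'I_k -> 'I_n, injective s /\
    exists U : set 'rV[R]_k, eucl_open U /\ (exists u, U u) /\
      U `<=` coord_proj s @` A.

Definition has_dim (R : rcfType) (n : nat) (A : set 'rV[R]_n) (d : nat) : Prop :=
  dim_ge A d /\ forall k, dim_ge A k -> (k <= d)%N.

Definition is_topology (T : Type) (V : set T) (tau : set (set T)) : Prop :=
  [/\ tau V, tau set0, (forall O, tau O -> O `<=` V),
      (forall O1 O2, tau O1 -> tau O2 -> tau (O1 `&` O2)) &
      (forall F : set (set T), F `<=` tau -> tau [set x | exists O, F O /\ O x])].

Definition definable_manifold (R : rcfType) (D : forall n, set (set 'rV[R]_n))
  (m : nat) (V : set 'rV[R]_m) (tau : set (set 'rV[R]_m)) (d : nat) : Prop :=
  D m V /\ is_topology V tau /\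
  exists (N : nat) (U : 'I_N -> set 'rV[R]_m) (phi : 'I_N -> 'rV[R]_m -> 'rV[R]_d),
    (forall x, V x <-> exists i, U i x) /\
    forall i, [/\ tau (U i) /\ D m (U i), def_fun D (U i) (phi i),
      eucl_open (phi i @` U i) /\ D d (phi i @` U i),
      (forall x y, U i x -> U i y -> phi i x = phi i y -> x = y) &
      (forall O, O `<=` U i -> (tau O <-> eucl_open (phi i @` O)))].

Definition prod_set (R : rcfType) (a b : nat) (A : set 'rV[R]_a) (B : set 'rV[R]_b)
  : set 'rV[R]_(a + b) := [set p | A (lsubmx p) /\ B (rsubmx p)].

Definition prod_top (R : rcfType) (a b : nat)
  (tA : set (set 'rV[R]_a)) (tB : set (set 'rV[R]_b)) : set (set 'rV[R]_(a + b)) :=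
  [set O | forall p, O p -> exists U W, [/\ tA U, tB W, U (lsubmx p), W (rsubmx p) &
      forall q, U (lsubmx q) -> W (rsubmx q) -> O q]].

Definition continuous_on (S T : Type) (X : set S) (tX : set (set S))
  (tY : set (set T)) (f : S -> T) : Prop :=
  forall O, tY O -> tX [set x | X x /\ O (f x)].

Definition mul2 (R : rcfType) (m : nat) (mul : 'rV[R]_m -> 'rV[R]_m -> 'rV[R]_m)
  (p : 'rV[R]_(m + m)) : 'rV[R]_m := mul (lsubmx p) (rsubmx p).

Definition definable_group (R : rcfType) (D : forall n, set (set 'rV[R]_n))
  (m : nat) (G : set 'rV[R]_m) (mul : 'rV[R]_m -> 'rV[R]_m -> 'rV[R]_m)
  (e : 'rV[R]_m) (inv : 'rV[R]_m -> 'rV[R]_m) : Prop :=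
  [/\ D m G /\ def_fun D (prod_set G G) (mul2 mul), G e,
      (forall g h, G g -> G h -> G (mul g h)) /\ (forall g, G g -> G (inv g)),
      (forall g h k, G g -> G h -> G k -> mul g (mul h k) = mul (mul g h) k) &
      (forall g, G g -> [/\ mul e g = g, mul g e = g, mul (inv g) g = e &
                           mul g (inv g) = e])].

Definition topological_group (R : rcfType) (m : nat) (G : set 'rV[R]_m)
  (mul : 'rV[R]_m -> 'rV[R]_m -> 'rV[R]_m) (inv : 'rV[R]_m -> 'rV[R]_m)
  (tauG : set (set 'rV[R]_m)) : Prop :=
  [/\ is_topology G tauG,
      continuous_on (prod_set G G) (prod_top tauG tauG) tauG (mul2 mul) &
      continuous_on G tauG tauG inv].

Definition definable_transitive_action (R : rcfType) (D : forall n, set (set 'rV[R]_n))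
  (m k : nat) (G : set 'rV[R]_m) (mul : 'rV[R]_m -> 'rV[R]_m -> 'rV[R]_m)
  (e : 'rV[R]_m) (V : set 'rV[R]_k) (alpha : 'rV[R]_m -> 'rV[R]_k -> 'rV[R]_k) : Prop :=
  [/\ def_fun D (prod_set G V) (fun p => alpha (lsubmx p) (rsubmx p)),
      (forall g v, G g -> V v -> V (alpha g v)),
      (forall v, V v -> alpha e v = v),
      (forall g h v, G g -> G h -> V v -> alpha (mul g h) v = alpha g (alpha h v)) &
      (forall v w, V v -> V w -> exists2 g, G g & alpha g v = w)].

(* Main.v *)
(** The orbit map has a definable section and, in charts, a definable map from
    a box of [M^n] into [M^d] has a point of continuity. At such a point the
    section lands, for nearby arguments, in any prescribed neighbourhood of its
    value [h], so the orbit map is open at [h]; translating by the group it is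
    open everywhere.

    Definable choice and generic continuity come from o-minimality on the line.
    Every box contains a smaller box that lies in a given definable set or
    misses it; this and generic continuity are proved together by induction on
    the dimension, slicing along the last coordinate. On the line, a definable
    Baire category argument makes locally chosen radii uniform on a subinterval,
    which yields monotonicity there. *)

Require Import Defs.
From mathcomp Require Import all_boot all_order all_algebra.
From mathcomp Require Import boolp classical_sets.
From mathcomp Require Import zify lra.
Import Order.TTheory GRing.Theory Num.Theory.
Local Open Scope classical_set_scope.

(** The field [R] may be non-archimedean and incomplete, so neither limits of sequences nor the
    countable Baire theorem is available. Infima exist for definable sets, and each auxiliary set
    has to be shown definable before o-minimality says anything about it; hence the calculus of
    formulas. The two halves of the induction feed each other. The one-variable facts give, on each
    slice, an interval that depends on the base point; continuity in [n] variables freezes a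
    definable choice of it over a smaller box, which yields the dichotomy in [n + 1] variables. The
    dichotomy in turn thickens a dense definable set, such as the points where a function is
    continuous in the first [n] variables, to a box. *)

Section Definability.
Open Scope ring_scope.
Context {R : rcfType} {D : forall n, set (set 'rV[R]_n)}.
Hypothesis HD : ominimal_field_structure D.

Notation shift e := (fun i => e i.+1).
Notation shiftn n e := (fun i => e (n + i)%N).

(** * Definability as a calculus of formulas *)

Section Predicates.
Implicit Types (P Q : (nat -> R) -> Prop) (t w : (nat -> R) -> R) (e u : nat -> R).

Definition ext {n} (x : 'rV[R]_n) : nat -> R :=
  fun i => if insub i is Some j then x 0 j else 0.

Lemma ext_ord n (x : 'rV[R]_n) (i : 'I_n) : ext x i = x 0 i.
Proof. by rewrite /ext valK. Qed.

Definition supp (n : nat) P :=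
  forall e e', (forall i, (i < n)%N -> e i = e' i) -> P e -> P e'.

(** The set only tests environments padded with zeros from position [n] on; [supp] makes the truth
    of [P] independent of that padding. *)
Definition DefN n P := supp n P /\ D n [set x | P (ext x)].

Lemma DefN_ext n P Q : (forall e, P e <-> Q e) -> DefN n P -> DefN n Q.
Proof. by move=> PQ; have -> : P = Q by apply/funext => e; apply/propext. Qed.

Lemma DefN_not n P : DefN n P -> DefN n (fun e => ~ P e).
Proof.
move=> [sP dP]; split; last exact: om_setC HD _ _ dP.
by move=> e e' ee' nP /sP; apply: contra_not nP => /(_ e); apply => i /ee'.
Qed.

Lemma DefN_or n P Q : DefN n P -> DefN n Q -> DefN n (fun e => P e \/ Q e).
Proof.
move=> [sP dP] [sQ dQ]; split; last exact: om_setU HD _ _ _ dP dQ.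
by move=> e e' ee' [/sP|/sQ] h; [left|right]; apply: h.
Qed.

Lemma DefN_true n : DefN n (fun=> True).
Proof. by split => //; exact: om_setT HD n. Qed.

Lemma DefN_and n P Q : DefN n P -> DefN n Q -> DefN n (fun e => P e /\ Q e).
Proof.
move=> dP dQ; apply: (@DefN_ext _ (fun e => ~ (~ P e \/ ~ Q e))).
  by move=> e; rewrite not_orE !notK.
by apply/DefN_not/DefN_or; exact: DefN_not.
Qed.

Lemma DefN_diag n i j : (i < n)%N -> (j < n)%N -> DefN n (fun e => e i = e j).
Proof.
move=> lin ljn; split; first by move=> e e' ee'; rewrite !ee'.
have := om_diag HD (Ordinal lin) (Ordinal ljn).
by congr (D _ _); apply/funext => x /=;
  rewrite -(ext_ord _ _ (Ordinal lin)) -(ext_ord _ _ (Ordinal ljn)).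
Qed.

Definition upd e n y : nat -> R := fun i => if i == n then y else e i.

Lemma DefN_proj n P : DefN n.+1 P -> DefN n (fun e => exists y, P (upd e n y)).
Proof.
rewrite -addn1 => -[sP dP]; split.
  move=> e e' ee' [y Py]; exists y; apply: sP Py => i; rewrite addn1 ltnS /upd => lein.
  by case: eqVneq => // ni; apply: ee'; rewrite ltn_neqAle ni.
have := om_proj HD dP; congr (D _ _); apply/funext => x /=; apply/propext.
have E (y : 'rV_1) i : (i < n + 1)%N -> ext (row_mx x y) i = upd (ext x) n (y 0 0) i.
  move=> lti; rewrite -[i]/(val (Ordinal lti)) ext_ord mxE /upd.
  case: splitP => j /= ->; first by rewrite ext_ord ltn_eqF.
  by rewrite ord1 addn0 eqxx.
split=> [[y Py]|[y Py]].
  by exists (y 0 0); apply: sP Py => i /E.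
exists (const_mx y); apply: sP Py => i /E ->.
by rewrite mxE.
Qed.

Lemma DefN_shift n k Q : DefN k Q -> DefN (n + k) (fun e => Q (fun i => e (n + i)%N)).
Proof.
move=> [sQ dQ]; split.
  by move=> e e' ee'; apply: sQ => i lti; apply: ee'; rewrite ltn_add2l.
have := om_prod HD (om_setT HD n) dQ; congr (D _ _); apply/funext => z /=; apply/propext.
have E (x : 'rV_n) (y : 'rV_k) i : (i < k)%N -> ext (row_mx x y) (n + i) = ext y i.
  move=> lti; rewrite -[i in RHS]/(val (Ordinal lti)) ext_ord.
  by rewrite -[(n + i)%N]/(val (rshift n (Ordinal lti))) ext_ord row_mxEr.
split=> [[x [y [_ [Qy ->]]]]|Qz].
  by apply: sQ Qy => i lti; rewrite E.
exists (lsubmx z), (rsubmx z); split => //; rewrite hsubmxK; split => //.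
by apply: sQ Qz => i lti; rewrite -(E (lsubmx z)) // hsubmxK.
Qed.

Lemma DefN_weak n N P : (n <= N)%N -> DefN n P -> DefN N P.
Proof.
move=> /subnKC <-; set k := (N - n)%N => -[sP dP]; split.
  by move=> e e' ee'; apply: sP => i lti; apply: ee'; rewrite ltn_addr.
have := om_prod HD dP (om_setT HD k); congr (D _ _); apply/funext => z /=; apply/propext.
have E (x : 'rV_n) (y : 'rV_k) i : (i < n)%N -> ext (row_mx x y) i = ext x i.
  move=> lti; rewrite -[i in RHS]/(val (Ordinal lti)) ext_ord.
  by rewrite -[i]/(val (lshift k (Ordinal lti))) ext_ord row_mxEl.
split=> [[x [y [Py [_ ->]]]]|Pz].
  by apply: sP Py => i lti; rewrite E.
exists (lsubmx z), (rsubmx z); split; last by rewrite hsubmxK.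
by apply: sP Pz => i lti; rewrite -(E _ (rsubmx z)) // hsubmxK.
Qed.

Lemma DefN_projs n k P : DefN (n + k) P ->
  DefN n (fun e => exists u, P (fun i => if (i < n)%N then e i else u (i - n)%N)).
Proof.
elim: k P => [|k IH] P.
  rewrite addn0 => -[sP dP]; split.
    by move=> e e' ee' [u Pu]; exists u; apply: sP Pu => i lti; rewrite lti ee'.
  move: dP; congr (D _ _); apply/funext => x /=; apply/propext.
  split=> [Px|[u Pu]]; first by exists (fun=> 0); apply: sP Px => i ->.
  by apply: sP Pu => i ->.
rewrite addnS => dP; have [sP _] := dP; apply: DefN_ext (IH _ (DefN_proj _ _ dP)) => e.
split=> [[u [y Pu]]|[u Pu]].
  exists (fun i => if (i < k)%N then u i else y); apply: sP Pu => i lti.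
  by rewrite /upd; case: eqVneq => ?; case: (ltnP i n) => ? //; try lia;
    case: (ltnP (i - n) k) => ? //; lia.
exists u, (u k); apply: sP Pu => i lti; rewrite /upd.
by case: eqVneq => ?; case: (ltnP i n) => // ?; [lia|congr u; lia].
Qed.

Lemma DefN_all n N (P : nat -> (nat -> R) -> Prop) :
  (forall i, (i < N)%N -> DefN n (P i)) -> DefN n (fun e => forall i, (i < N)%N -> P i e).
Proof.
elim: N => [|N IH] dP; first by apply: DefN_ext (DefN_true n).
apply: DefN_ext (DefN_and _ _ _ (IH _) (dP N (ltnSn N))).
  move=> e; split=> [[h hN] i|h]; last by split; [move=> i ?; apply: h; lia|apply: h].
  by rewrite ltnS leq_eqVlt => /orP[/eqP ->|/h].
by move=> i lti; apply: dP; lia.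
Qed.

(** Variables may be permuted, merged or dropped although the axioms only project the last
    coordinate: [k] fresh coordinates are appended, forced by diagonals to equal the [e (s i)],
    passed to [P] and projected away. *)
Lemma DefN_ren k n s P : DefN k P -> (forall i, (i < k)%N -> (s i < n)%N) ->
  DefN n (fun e => P (fun i => e (s i))).
Proof.
move=> dP sn; have [sP _] := dP.
have dE : DefN (n + k) (fun e => forall i, (i < k)%N -> e (n + i)%N = e (s i)).
  by apply: DefN_all => i lti; apply: DefN_diag; [lia|have := sn _ lti; lia].
apply: DefN_ext (DefN_projs _ _ _ (DefN_and _ _ _ dE (DefN_shift n _ _ dP))) => e.
split=> [[u [E Pu]]|Pe].
  by apply: sP Pu => i lti; rewrite E // sn.
exists (fun i => e (s i)); split=> [i lti|].
  by rewrite sn // ltnNge leq_addr addKn.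
by apply: sP Pe => i lti; rewrite ltnNge leq_addr addKn.
Qed.

(** Formulas are predicates on environments [nat -> R] (variable [i] is [e i])
    and are closed under quantifiers in de Bruijn style. *)
Definition Def P := exists n, DefN n P.

Lemma Def_ext P Q : (forall e, P e <-> Q e) -> Def P -> Def Q.
Proof. by move=> PQ [n /(DefN_ext _ _ _ PQ)]; exists n. Qed.

Lemma Def_not P : Def P -> Def (fun e => ~ P e).
Proof. by move=> [n /DefN_not]; exists n. Qed.

Lemma Def_or P Q : Def P -> Def Q -> Def (fun e => P e \/ Q e).
Proof.
move=> [n dP] [k dQ]; exists (n + k)%N.
by apply: DefN_or; [apply: DefN_weak dP|apply: DefN_weak dQ]; lia.
Qed.

Lemma Def_true (A : Prop) : Def (fun=> A).
Proof.
have [a|na] := EM A; exists 0%N; first exact: DefN_ext (DefN_true 0).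
by apply: DefN_ext (DefN_not _ _ (DefN_true 0)) => e; tauto.
Qed.

Lemma Def_and P Q : Def P -> Def Q -> Def (fun e => P e /\ Q e).
Proof.
move=> dP dQ; apply: (@Def_ext (fun e => ~ (~ P e \/ ~ Q e))).
  by move=> e; rewrite not_orE !notK.
by apply/Def_not/Def_or; exact: Def_not.
Qed.

Lemma Def_imp P Q : Def P -> Def Q -> Def (fun e => P e -> Q e).
Proof.
move=> dP dQ; apply: (@Def_ext (fun e => ~ P e \/ Q e)).
  by move=> e; rewrite -implyE.
exact: Def_or (Def_not _ dP) dQ.
Qed.

Lemma Def_ren s P : Def P -> Def (fun e => P (fun i => e (s i))).
Proof.
move=> [k dP]; exists (\max_(i < k) s i).+1; apply: DefN_ren dP _ => i lti.
by rewrite ltnS (leq_bigmax (Ordinal lti)).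
Qed.

Definition scons y e : nat -> R := fun i => if i is j.+1 then e j else y.
Lemma Def_ex (P : (nat -> R) -> R -> Prop) :
  Def (fun e => P (shift e) (e 0%N)) -> Def (fun e => exists y, P e y).
Proof.
move=> [N [sP dP]].
(* Projection removes the last coordinate, while the bound variable is number 0; [s] moves it to
   position [N], beyond the parameters that matter. *)
pose s i := if i is j.+1 then j else N.
have /DefN_proj : DefN N.+1 (fun e => P (shift (fun i => e (s i))) (e (s 0%N))).
  by apply: (DefN_ren N.+1 N.+1 s _ (DefN_weak _ _ _ (leqnSn N) (conj sP dP))) => -[|i]; rewrite //= => /ltnW.
move=> dQ; exists N; apply: DefN_ext dQ => e.
have E y : (fun i => upd e N y (s i)) 0%N = y by rewrite /upd /= eqxx.
split=> -[y Py]; exists y.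
  apply: (sP (fun i => upd e N y (s i)) (scons y e)) Py => -[|i] lti; first exact: E.
  by rewrite /upd /= ltn_eqF // ltnW.
apply: (sP (scons y e) (fun i => upd e N y (s i))) Py => -[|i] lti; first by rewrite E.
by rewrite /upd /= ltn_eqF // ltnW.
Qed.

Lemma Def_all (P : (nat -> R) -> R -> Prop) :
  Def (fun e => P (shift e) (e 0%N)) -> Def (fun e => forall y, P e y).
Proof.
move=> dP; apply: (@Def_ext (fun e => ~ exists y, ~ P e y)).
  by move=> e; split=> [h y|h [y []//]]; apply: contrapT => nP; apply: h; exists y.
by apply/Def_not/Def_ex/Def_not.
Qed.

Lemma Def_alln N (P : nat -> (nat -> R) -> Prop) :
  (forall i, (i < N)%N -> Def (P i)) -> Def (fun e => forall i, (i < N)%N -> P i e).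
Proof.
elim: N => [|N IH] dP; first by apply: Def_ext (Def_true True).
apply: Def_ext (Def_and _ _ (IH _) (dP N (ltnSn N))).
  move=> e; split=> [[h hN] i|h]; last by split; [move=> i ?; apply: h; lia|apply: h].
  by rewrite ltnS leq_eqVlt => /orP[/eqP ->|/h].
by move=> i lti; apply: dP; lia.
Qed.

Definition splice n (u e : nat -> R) : nat -> R :=
  fun i => if (i < n)%N then u i else e i.

Lemma Def_exs n (P : (nat -> R) -> Prop) : Def P ->
  Def (fun e => exists u, P (fun i => if (i < n)%N then u i else e (i - n)%N)).
Proof.
elim: n P => [|n IH] P dP.
  apply: Def_ext dP => e; have E : (fun i => e (i - 0)%N) = e by apply/funext=> i; rewrite subn0.
  by rewrite /= E; split=> [?|[]//]; exists (fun=> 0).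
have /IH : Def (fun e => exists y, P (scons y e)).
  apply: Def_ex; apply: Def_ext dP => e.
  by have -> : scons (e 0%N) (shift e) = e by apply/funext => -[].
apply: Def_ext => e; split=> [[u [y Pu]]|[u Pu]].
  exists (scons y u); move: Pu; congr P; apply/funext => -[|i] //=.
exists (shift u), (u 0%N); move: Pu; congr P; apply/funext => -[|i] //=.
Qed.

Lemma Def_exn n (P : (nat -> R) -> (nat -> R) -> Prop) :
  Def (fun e => P (shiftn n e) (splice n e (shiftn n e))) ->
  Def (fun e => exists u, P e (splice n u e)).
Proof.
move=> /(Def_exs n); apply: Def_ext => e.
have E u : (shiftn n (fun i => if (i < n)%N then u i else e (i - n)%N)) = e.
  by apply/funext => i; rewrite ltnNge leq_addr addKn.
split=> -[u]; rewrite ?E => Pu; exists u; rewrite ?E; move: Pu; congr P; apply/funext=> i;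
  by rewrite /splice; case: ifP => //= ->.
Qed.

Definition DefT t := Def (fun e => e 0%N = t (shift e)).

(** Only the first [N] variables of [P] matter, so the infinitely many terms of [s] reduce to [N]
    quantified variables forced to equal the terms. *)
Lemma Def_subst P (s : (nat -> R) -> nat -> R) :
  Def P -> (forall i, DefT (fun e => s e i)) -> Def (fun e => P (s e)).
Proof.
move=> [N dP] ds; have [sP _] := dP.
have /(Def_exs N) : Def (fun e => (forall i, (i < N)%N -> e i = s (shiftn N e) i) /\ P e).
  apply: Def_and; last by exists N.
  apply: Def_alln => i _.
  by have := Def_ren (fun j => if j is j.+1 then (N + j)%N else i) _ (ds i).
apply: Def_ext => e.
have E u : (shiftn N (fun i => if (i < N)%N then u i else e (i - N)%N)) = e.
  by apply/funext => i; rewrite ltnNge leq_addr addKn.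
split=> [[u []]|Ps].
  by rewrite E => uE; apply: sP => i lti; rewrite -uE // lti.
exists (s e); rewrite E; split=> [i ->//|].
by apply: sP Ps => i ->.
Qed.

Lemma DefT_var i : DefT (fun e => e i).
Proof. by exists i.+2; apply: DefN_diag. Qed.

Lemma DefT_const a : DefT (fun=> a).
Proof.
exists 1%N; split; first by move=> e e' -> .
have := om_point HD a; congr (D _ _); apply/funext => x /=.
by rewrite -(ext_ord _ _ 0).
Qed.

Lemma Def_eq t w : DefT t -> DefT w -> Def (fun e => t e = w e).
Proof.
move=> dt du.
have d01 : Def (fun e => e 0%N = e 1%N) by exists 2%N; apply: DefN_diag.
apply: (Def_subst _ (fun e i => if i is 0%N then t e else w e) d01).
by case.
Qed.

Lemma Def_set n (A : set 'rV[R]_n) (X : (nat -> R) -> 'rV[R]_n) :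
  D n A -> (forall i, DefT (fun e => X e 0 i)) -> Def (fun e => A (X e)).
Proof.
move=> dA dX.
have dA' : Def (fun e => A (\row_i e i)).
  exists n; split=> [e e' ee'|].
    by congr A; apply/rowP => i; rewrite !mxE ee'.
  move: dA; congr (D _ _); apply/funext => x /=; congr A.
  by apply/rowP => i; rewrite mxE ext_ord.
have := Def_subst _ (fun e i => ext (X e) i) dA'.
have E e : \row_i ext (X e) (nat_of_ord i) = X e by apply/rowP => i; rewrite mxE ext_ord.
move=> h; apply: Def_ext (h _) => [e|i]; first by rewrite E.
rewrite /ext; case: insubP => [j _ _|_]; [exact: dX|exact: DefT_const].
Qed.

Lemma Def_lt t w : DefT t -> DefT w -> Def (fun e => t e < w e).
Proof.
move=> dt du.
pose X e : 'rV[R]_2 := \row_i (if i == 0 then t e else w e).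
apply: Def_ext (Def_set _ _ X (om_lt HD) _).
  by move=> e; rewrite /X /= !mxE -!val_eqE /= !inordK.
by move=> i; under eq_fun do rewrite mxE; case: (i == 0).
Qed.

Lemma Def_add t w t2 : DefT t -> DefT w -> DefT t2 -> Def (fun e => t e + w e = t2 e).
Proof.
move=> dt du dw.
pose X e : 'rV[R]_3 := \row_i (if i == 0 then t e else if i == 1 then w e else t2 e).
apply: Def_ext (Def_set _ _ X (om_add HD) _).
  by move=> e; rewrite /X /= !mxE -!val_eqE /= !inordK.
by move=> i; under eq_fun do rewrite mxE; case: (i == 0); case: (i == 1).
Qed.

Lemma DefT_ren s t : DefT t -> DefT (fun e => t (fun i => e (s i))).
Proof.
by move=> /(Def_ren (fun i => if i is j.+1 then (s j).+1 else 0%N)).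
Qed.

Lemma DefT_graph t (P : (nat -> R) -> R -> Prop) :
  (forall e y, y = t e <-> P e y) -> Def (fun e => P (shift e) (e 0%N)) -> DefT t.
Proof. by move=> tP; apply: Def_ext => e; rewrite tP. Qed.

Lemma DefT_subst t (s : (nat -> R) -> nat -> R) :
  DefT t -> (forall i, DefT (fun e => s e i)) -> DefT (fun e => t (s e)).
Proof.
move=> dt ds; apply: (Def_subst _ (fun e => scons (e 0%N) (s (shift e))) dt).
by case=> [|i]; [exact: DefT_var|exact: (DefT_ren S _ (ds i))].
Qed.

Lemma Def_le t w : DefT t -> DefT w -> Def (fun e => t e <= w e).
Proof.
move=> dt du; apply: Def_ext (Def_not _ (Def_lt _ _ du dt)) => e.
by rewrite leNgt; split=> /negP.
Qed.

Lemma DefT_add t w : DefT t -> DefT w -> DefT (fun e => t e + w e).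
Proof.
move=> dt du; apply: (DefT_graph _ (fun e y => t e + w e = y)); first by split.
by apply: Def_add; [apply: DefT_ren|apply: DefT_ren|apply: DefT_var].
Qed.

Lemma DefT_opp t : DefT t -> DefT (fun e => - t e).
Proof.
move=> dt; apply: (DefT_graph _ (fun e y => t e + y = 0)).
  by move=> e y; split=> ?; lra.
by apply: Def_add; [apply: DefT_ren|apply: DefT_var|apply: DefT_const].
Qed.

Lemma DefT_half t : DefT t -> DefT (fun e => t e / 2).
Proof.
move=> dt; apply: (DefT_graph _ (fun e y => y + y = t e)).
  by move=> e y; split=> ?; lra.
by apply: Def_add; [apply: DefT_var|apply: DefT_var|apply: DefT_ren].
Qed.

Lemma DefT_if P t w : Def P -> DefT t -> DefT w ->
  DefT (fun e => if `[< P e >] then t e else w e).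
Proof.
move=> dP dt du.
apply: (DefT_graph _ (fun e y => (P e /\ y = t e) \/ (~ P e /\ y = w e))).
  by move=> e y; case: asboolP => h; tauto.
by apply: Def_or; apply: Def_and => //; try apply: Def_not; exact: (Def_ren S).
Qed.

Lemma DefT_norm t : DefT t -> DefT (fun e => `|t e|).
Proof.
move=> dt; apply: Def_ext (DefT_if _ _ _ (Def_le (fun=> 0) t (DefT_const 0) dt) dt (DefT_opp _ dt)) => e.
by case: asboolP => h; [rewrite (ger0_norm h)|rewrite ler0_norm //; lra].
Qed.

Lemma DefT_upd (s : (nat -> R) -> nat -> R) t n : (forall i, DefT (fun e => s e i)) ->
  DefT t -> forall i, DefT (fun e => upd (s e) n (t e) i).
Proof. by move=> ds dt i; rewrite /upd; case: (i == n). Qed.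

Lemma DefT_splice (s s' : (nat -> R) -> nat -> R) n :
  (forall i, DefT (fun e => s e i)) -> (forall i, DefT (fun e => s' e i)) ->
  forall i, DefT (fun e => splice n (s e) (s' e) i).
Proof. by move=> ds ds' i; rewrite /splice; case: (i < n)%N. Qed.

Definition Def1 (S : R -> Prop) := Def (fun e => S (e 0%N)).
Definition Def2 (S : R -> R -> Prop) := Def (fun e => S (e 0%N) (e 1%N)).
Definition DefT1 (g : R -> R) := DefT (fun e => g (e 0%N)).

Lemma Def1_app S t : Def1 S -> DefT t -> Def (fun e => S (t e)).
Proof. by move=> dS dt; apply: (Def_subst _ (fun e _ => t e) dS). Qed.

Lemma Def2_app S t w : Def2 S -> DefT t -> DefT w -> Def (fun e => S (t e) (w e)).
Proof.
move=> dS dt dw; apply: (Def_subst _ (fun e i => if i is 0%N then t e else w e) dS).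
by case.
Qed.

Lemma DefT1_app g t : DefT1 g -> DefT t -> DefT (fun e => g (t e)).
Proof. by move=> dS dt; apply: (DefT_subst _ (fun e _ => t e) dS). Qed.

Lemma Def_ex2 (P Q : (nat -> R) -> R -> Prop) :
  Def (fun e => P (shift e) (e 0%N)) -> Def (fun e => Q (shift e) (e 0%N)) ->
  Def (fun e => exists2 y, P e y & Q e y).
Proof.
move=> dP dQ; apply: Def_ext (Def_ex (fun e y => P e y /\ Q e y) (Def_and _ _ dP dQ)) => e.
by split=> [[y []]|[y]]; exists y.
Qed.

Definition DefR (P : (nat -> R) -> R -> Prop) := Def (fun e => P (shift e) (e 0%N)).
Definition DefR2 (P : (nat -> R) -> R -> R -> Prop) :=
  Def (fun e => P (shift (shift e)) (e 0%N) (e 1%N)).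

Lemma DefR_app (P : (nat -> R) -> R -> Prop) (s : (nat -> R) -> nat -> R) t :
  DefR P -> (forall i, DefT (fun e => s e i)) -> DefT t -> Def (fun e => P (s e) (t e)).
Proof.
move=> dP ds dt; apply: (Def_subst _ (fun e => scons (t e) (s e)) dP).
by case=> [|i]; [exact: dt|exact: ds].
Qed.

Lemma DefR2_app (P : (nat -> R) -> R -> R -> Prop) (s : (nat -> R) -> nat -> R) t w :
  DefR2 P -> (forall i, DefT (fun e => s e i)) -> DefT t -> DefT w ->
  Def (fun e => P (s e) (t e) (w e)).
Proof.
move=> dP ds dt dw; apply: (Def_subst _ (fun e => scons (t e) (scons (w e) (s e))) dP).
by case=> [|[|i]]; [exact: dt|exact: dw|exact: ds].
Qed.

(** The cube around [c] of radius [r] in the first [n] variables; the other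
    variables are parameters. *)
Definition cube n (c : nat -> R) (r : R) (e : nat -> R) :=
  forall i, ((i < n)%N -> `|e i - c i| < r) /\ ((n <= i)%N -> e i = c i).

(** The quantified [e'] is an infinite sequence, but in the cube it agrees with [s e] from [n] on,
    so only its first [n] entries have to be quantified. *)
Lemma Def_box n (P : (nat -> R) -> (nat -> R) -> Prop) (s : (nat -> R) -> nat -> R) t :
  (forall i, DefT (fun e => s e i)) -> DefT t ->
  Def (fun e => P (shiftn n e) (splice n e (s (shiftn n e)))) ->
  Def (fun e => forall e', cube n (s e) (t e) e' -> P e e').
Proof.
move=> ds dt dP.
pose Q e u := (forall i, (i < n)%N -> `|u i - s e i| < t e) /\ ~ P e (splice n u (s e)).
have : Def (fun e => exists u, Q e (splice n u e)).
  apply: Def_exn; apply: Def_and.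
    apply: Def_alln => i lti; apply: Def_lt; last exact: DefT_ren.
    apply: DefT_norm; apply: DefT_add; last by apply: DefT_opp; exact: (DefT_ren _ _ (ds i)).
    by apply: Def_ext (DefT_var i) => e; rewrite /splice lti.
  apply: Def_not; apply: Def_ext dP => e.
  suff -> : splice n (splice n e (shiftn n e)) (s (shiftn n e)) = splice n e (s (shiftn n e)) by [].
  by apply/funext => i; rewrite /splice; case: (i < n)%N.
move=> /Def_not; apply: Def_ext => e; split=> [h e' be'|h [u [hu nP]]].
  apply: contrapT => nP; apply: h; exists e'.
  have E : splice n (splice n e' e) (s e) = e'.
    by apply/funext => i; rewrite /splice; case: ltnP => [//|/(be' i).2 ->].
  by split=> [i lti|]; rewrite ?E // /splice lti; apply: (be' i).1.
apply: nP; apply: h => i; split=> lti; rewrite /splice ?lti ?ltnNge ?lti //=.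
by have := hu i lti; rewrite /splice lti.
Qed.

Lemma Def_andb (a b : (nat -> R) -> bool) :
  Def (fun e => a e) -> Def (fun e => b e) -> Def (fun e => a e && b e).
Proof. by move=> da db; apply: Def_ext (Def_and _ _ da db) => e; split=> /andP. Qed.

End Predicates.

(** Recursion on the shape of the formula; definability hypotheses of the context serve the
    predicates and functions that are variables. *)
Ltac definability := repeat first
  [ match goal with
    | H : Def1 ?S |- Def (fun e => ?S (@?t e)) => refine (Def1_app S t H _)
    | H : Def2 ?S |- Def (fun e => ?S (@?t e) (@?w e)) => refine (Def2_app S t w H _ _)
    | H : DefR ?P |- Def (fun e => ?P (@?s e) (@?t e)) => refine (DefR_app P s t H _ _)
    | H : DefR2 ?P |- Def (fun e => ?P (@?s e) (@?t e) (@?w e)) => refine (DefR2_app P s t w H _ _ _)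
    | H : DefT1 ?g |- DefT (fun e => ?g (@?t e)) => refine (DefT1_app g t H _)
    | H : Def ?P |- Def (fun e => ?P (@?s e)) => refine (Def_subst P s H _)
    | H : DefT ?g |- DefT (fun e => ?g (@?s e)) => refine (DefT_subst g s H _)
    | H : forall i, DefT (@?g i) |- DefT (fun e => ?g' ?i (@?s e)) => refine (DefT_subst (g' i) s (H i) _)
    | |- forall i : nat, DefT (fun e => upd (@?s e) ?n (@?t e) i) => refine (DefT_upd s t n _ _)
    | |- forall i : nat, DefT (fun e => splice ?n (@?s e) (@?s' e) i) => refine (DefT_splice s s' n _ _)
    | |- forall i : nat, DefT _ => intro
    | |- forall i : nat, is_true (_ < _)%N -> Def _ => intros ? _
    end
  | exact (DefT_var _)
  | exact (DefT_const _)
  | refine (DefT_norm _ _) | refine (DefT_opp _ _) | refine (DefT_half _ _)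
  | refine (DefT_add _ _ _ _)
  | refine (Def_lt _ _ _ _) | refine (Def_le _ _ _ _) | refine (Def_eq _ _ _ _)
  | refine (Def_true _)
  | refine (Def_andb _ _ _ _) | refine (Def_and _ _ _ _) | refine (Def_or _ _ _ _) | refine (Def_not _ _)
  | refine (Def_box _ _ _ _ _ _ _) | refine (Def_ex2 _ _ _ _) | refine (Def_ex _ _)
  | refine (Def_all _ _) | refine (Def_alln _ _ _)
  | refine (Def_imp _ _ _ _) ]; cbv beta.

(** * Definable subsets and functions of the line *)

(** The finite union in [om_omin] as an induction principle: a property stable under binary unions
    is checked on points and intervals. *)
Lemma omin_ind (Q : (R -> Prop) -> Prop) : Q (fun=> False) ->
  (forall I, point_or_interval I -> Q I) ->
  (forall A B : R -> Prop, Q A -> Q B -> Q (fun x => A x \/ B x)) ->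
  forall S, Def1 S -> Q S.
Proof.
move=> Q0 QI QU S [n dS].
have [_] := DefN_ren n 1 (fun=> 0%N) _ dS (fun _ _ => isT).
have -> : [set x : 'rV[R]_1 | S (ext x 0)] = [set x | S (x 0 0)].
  by apply/funext => x; congr S; exact: (ext_ord _ x 0).
move=> /(om_omin HD) [N [I [PI E]]].
have -> : S = (fun x => exists i, I i x).
  by apply/funext => y; move/(congr1 (@^~ (const_mx y))): E; rewrite /= mxE.
elim: N I PI {E} => [|N IH] I PI.
  by have -> : (fun x => exists i, I i x) = (fun=> False) by apply/funext => x; apply/propext; split=> // -[[]].
have -> : (fun x => exists i, I i x) = (fun x => I ord0 x \/ exists i, I (lift ord0 i) x).
  apply/funext => x; apply/propext; split=> [[i]|[?|[i ?]]]; [|by eexists; eassumption..].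
  by have [j ->|->] := unliftP ord0 i => h; [right; exists j|left].
by apply: QU; [exact: QI|apply: IH].
Qed.

(** Together with [ex_inf], this is all that the later arguments take from o-minimality. *)
Lemma germ_right S a : Def1 S -> exists2 b, a < b &
  (forall x, a < x < b -> S x) \/ (forall x, a < x < b -> ~ S x).
Proof.
move: S; apply: omin_ind.
- by exists (a + 1); [lra|right=> x _ []].
- move=> I [[c ->]|[[c [d ->]]|[[c ->]|[[d ->]|->]]]] /=.
  + have [ac|ca] := ltP a c; [exists c => //|exists (a + 1); [lra|]]; right=> x /andP[? ?] /= E; lra.
  + have [ac|ca] := ltP a c.
      by exists c => //; right=> x ? /= ?; lra.
    have [ad|da] := ltP a d; first by exists d => //; left=> x /=; lra.
    by exists (a + 1); [lra|right=> x ? /= ?; lra].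
  + have [ac|ca] := ltP a c; first by exists c => //; right=> x ? /= ?; lra.
    by exists (a + 1); [lra|left=> x /=; lra].
  + have [ad|da] := ltP a d; first by exists d => //; left=> x /=; lra.
    by exists (a + 1); [lra|right=> x ? /= ?; lra].
  + by exists (a + 1); [lra|left].
- move=> A B [b ab hA] [c ac hB].
  have [d ad [db dc]] : exists2 d, a < d & d <= b /\ d <= c.
    by have [?|?] := leP b c; [exists b|exists c] => //; lra.
  exists d => //; case: hA => hA.
    by left=> x ?; left; apply: hA; lra.
  case: hB => hB; first by left=> x ?; right; apply: hB; lra.
  by right=> x ? [/hA|/hB]; apply; lra.
Qed.

Lemma germ_interval S a b : Def1 S -> a < b -> exists2 c, a < c <= b &
  (forall x, a < x < c -> S x) \/ (forall x, a < x < c -> ~ S x).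
Proof.
move=> /(germ_right _ a) [c ac hc] ab.
have [?|?] := leP b c; [exists b|exists c] => //; try lra.
by case: hc => hc; [left|right] => x ?; apply: hc; lra.
Qed.

Definition is_inf (S : R -> Prop) (i : R) :=
  (forall x, S x -> i <= x) /\ (forall j, i < j -> exists2 x, S x & x < j).

Lemma is_inf_uniq S i j : is_inf S i -> is_inf S j -> i = j.
Proof.
move=> [i1 i2] [j1 j2]; apply/eqP; rewrite eq_le !leNgt; apply/andP; split; apply/negP.
  by move=> /j2 [x /i1]; lra.
by move=> /i2 [x /j1]; lra.
Qed.

Lemma ex_inf S m : Def1 S -> (exists x, S x) -> (forall x, S x -> m <= x) -> exists i, is_inf S i.
Proof.
(* Nonemptiness and boundedness do not pass to the two parts of a union, so the induction runs on
   this trichotomy. *)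
pose Q (S : R -> Prop) := (forall x, ~ S x) \/ (forall m, exists2 x, S x & x < m) \/ exists i, is_inf S i.
move=> dS [x0 Sx0] hm; have : Q S; last first.
  by move=> [/(_ x0)//|[/(_ m) [x /hm]|//]]; lra.
move: S dS {x0 Sx0 hm}; apply: omin_ind.
- by left=> x [].
- have P1 c (I : R -> Prop) : I c -> (forall x, I x -> c <= x) -> is_inf I c.
    by move=> Ic hI; split=> // j cj; exists c.
  move=> I [[c ->]|[[c [d ->]]|[[c ->]|[[d ->]|->]]]] /=.
  + by right; right; exists c; apply: P1 => // x ->.
  + have [dc|cd] := leP d c; first by left=> x /=; lra.
    right; right; exists c; split=> [x /=|j cj]; first by lra.
    have [jd|dj] := leP j d; first by exists ((c + j) / 2); rewrite /=; lra.
    by exists ((c + d) / 2); rewrite /=; lra.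
  + right; right; exists c; split=> [x /=|j cj]; first by lra.
    by exists ((c + j) / 2); rewrite /=; lra.
  + right; left=> m'; have [?|?] := leP d m'; [exists (d - 1)|exists (m' - 1)]; rewrite /=; lra.
  + by right; left=> m'; exists (m' - 1); rewrite //; lra.
- move=> A B [A0|[A0|[i [i1 i2]]]] [B0|[B0|[j [j1 j2]]]].
  + by left=> x [/A0|/B0].
  + by right; left=> m'; have [x ? ?] := B0 m'; exists x => //; right.
  + right; right; exists j; split=> [x [/A0//|/j1//]|l /j2 [x ? ?]].
    by exists x => //; right.
  1,2,3: by right; left=> m'; have [x ? ?] := A0 m'; exists x => //; left.
  + right; right; exists i; split=> [x [/i1//|/B0//]|l /i2 [x ? ?]].
    by exists x => //; left.
  + by right; left=> m'; have [x ? ?] := B0 m'; exists x => //; right.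
  + right; right; have [ij|ji] := leP i j.
      exists i; split=> [x [/i1//|/j1]|l /i2 [x ? ?]]; first by lra.
      by exists x => //; left.
    exists j; split=> [x [/i1|/j1//]|l /j2 [x ? ?]]; first by lra.
    by exists x => //; right.
Qed.

(** As [S] contains no interval, its germ to the right of the infimum is empty, so points of [S] can
    come close to the infimum only if it belongs to [S]. *)
Lemma ex_min S m : Def1 S -> (exists x, S x) -> (forall x, S x -> m <= x) ->
  (forall a b, a < b -> exists2 x, a < x < b & ~ S x) ->
  exists2 i, S i & forall x, S x -> i <= x.
Proof.
move=> dS Sx hm nS; have [i [i1 i2]] := ex_inf _ _ dS Sx hm.
exists i => //; have [b ib [hS|hS]] := germ_right _ i dS.
  by have [x /hS] := nS _ _ ib.
apply: contrapT => Si; have [x Sx' xb] := i2 _ ib.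
apply: (hS x) => //; rewrite xb andbT lt_neqAle i1 // andbT.
by apply/negP => /eqP E; apply: Si; rewrite E.
Qed.

(** A definable Baire category theorem on the line. The proof looks at the
    germ at [p] of the set of points [y] that carry a larger radius than all
    points between [p] and [y]. *)
Lemma uniform_radius (rho : R -> R -> Prop) p q : Def2 rho -> p < q ->
  (forall x s t, rho x t -> 0 < s <= t -> rho x s) ->
  (forall x, p < x < q -> exists2 t, 0 < t & rho x t) ->
  exists p' q' t, [/\ p <= p', p' < q', q' <= q, 0 < t & forall x, p' < x < q' -> rho x t].
Proof.
move=> dr pq mono hr; apply: contrapT => nrho.
have nr a b t : 0 < t -> a < b -> p <= a -> b <= q -> exists2 x, a < x < b & ~ rho x t.
  move=> t0 ab pa bq; apply: contrapT => h; apply: nrho; exists a, b, t; split=> // x axb.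
  by apply: contrapT => nx; apply: h; exists x.
pose K y := exists t, 0 < t /\ rho y t /\ forall z, p < z < y -> ~ rho z t.
have dK : Def1 K by rewrite /Def1 /K; definability.
have [c /andP[pc cq] [hK|hK]] := germ_interval _ _ _ dK pq.
  (* If all points near [p] lie in [K], monotonicity of [rho] passes the radius [t1] of [y1] on to
     every later point before [c], against [nr]. *)
  pose y1 := (p + c) / 2.
  have [t1 [t10 [r1 _]]] : K y1 by apply: hK; rewrite /y1; lra.
  have [x hx] := nr y1 c t1 t10 ltac:(rewrite /y1; lra) ltac:(rewrite /y1; lra) cq; apply.
  have [t [t0 [rt tmax]]] : K x by apply: hK; move: hx; rewrite /y1; lra.
  apply: (mono _ _ t) => //; rewrite t10 /= leNgt; apply/negP => tt1.
  apply: (tmax y1); first by move: hx; rewrite /y1; lra.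
  by apply: mono r1 _; lra.
(* If no point near [p] lies in [K], a contradiction comes from the leftmost point of radius [t]: it
   exists by [ex_min], since by [nr] such points fill no interval, and it lies in [K]. *)
have [y0 hy0] : exists y0, p < y0 < c by exists ((p + c) / 2); lra.
have [t t0 r0] : exists2 t, 0 < t & rho y0 t by apply: hr; lra.
pose S y := p < y <= y0 /\ rho y t.
have dS : Def1 S by rewrite /Def1 /S; definability.
have [|x [? _]||z [hz rz] zmin] := ex_min S p dS.
- by exists y0; split=> //; lra.
- by lra.
- move=> a b ab; have [?|?] := leP b p; first by exists ((a + b) / 2); [lra|move=> [? _]; lra].
  have [?|?] := leP y0 a; first by exists ((a + b) / 2); [lra|move=> [? _]; lra].
  have [a' [? ?]] : exists a', a <= a' /\ p <= a' < b /\ a' < y0.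
    by have [?|?] := leP p a; [exists a|exists p]; lra.
  have [b' [? ?]] : exists b', a' < b' <= b /\ b' <= y0.
    by have [?|?] := leP b y0; [exists b|exists y0]; lra.
  have [x hx nx] := nr a' b' t t0 ltac:(lra) ltac:(lra) ltac:(move: hy0; lra).
  by exists x; [lra|move=> []].
apply: (hK z); first by move: hz; lra.
exists t; split=> //; split=> // x hx rx.
by have := zmin x; rewrite /S => h; have := h ltac:(split=> //; lra); lra.
Qed.

Definition incr_on (g : R -> R) a b := forall x y, a < x -> x < y -> y < b -> g x <= g y.

(** On a subinterval, either every point has [g] at least its own value just to its right, or none
    has and then [g] is smaller just to the right. With a uniform radius, this compares any two
    points of an interval no longer than the radius. *)
Lemma monotone_subinterval g a b : DefT1 g -> a < b ->
  exists a' b', [/\ a <= a', a' < b', b' <= b &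
    incr_on g a' b' \/ incr_on (fun x => - g x) a' b'].
Proof.
move=> dg ab.
pose S x := exists t, 0 < t /\ forall y, x < y < x + t -> g x <= g y.
have dS : Def1 S by rewrite /Def1 /S; definability.
have [c /andP[ac cb] hS] := germ_interval _ _ _ dS ab.
have shrink (rho : R -> R -> Prop) (h : R -> R) : Def2 rho ->
    (forall x t, rho x t <-> forall y, x < y < x + t -> h x <= h y) ->
    (forall x, a < x < c -> exists2 t, 0 < t & rho x t) ->
    exists a' b', [/\ a <= a', a' < b', b' <= b & incr_on h a' b'].
  move=> dr rE hr; have [|a' [b' [t [aa' ab' bc t0 h1]]]] := uniform_radius _ _ _ dr ac _ hr.
    by move=> x s t /rE rt hs; apply/rE => y ?; apply: rt; lra.
  have [d [? ? ?]] : exists d, [/\ a' < d, d <= b' & d <= a' + t].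
    by have [?|?] := leP b' (a' + t); [exists b'|exists (a' + t)]; split; lra.
  exists a', d; split=> //; first by lra.
  by move=> x y ? ? ?; move/rE: (h1 x ltac:(lra)); apply; lra.
case: hS => hS.
  pose rho x t := forall y, x < y < x + t -> g x <= g y.
  have [||x /hS [t [? ?]]|a' [b' [? ? ? ?]]] := shrink rho g.
  - by rewrite /Def2 /rho; definability.
  - by [].
  - by exists t.
  - by exists a', b'; split=> //; left.
pose rho x t := forall y, x < y < x + t -> - g x <= - g y.
have [||x /hS nS|a' [b' [? ? ? ?]]] := shrink rho (fun x => - g x).
- by rewrite /Def2 /rho; definability.
- by [].
- have dx : Def1 (fun y => g x <= g y) by rewrite /Def1; definability.
  have [d xd [hd|hd]] := germ_right _ x dx.
    by case: nS; exists (d - x); split=> [|y ?]; [lra|apply: hd; lra].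
  exists (d - x) => [|y ?]; first by lra.
  by have /negP := hd y ltac:(lra); lra.
- by exists a', b'; split=> //; right.
Qed.

(** Only the upper bound is asked for; for increasing [g] this is right continuity. *)
Definition rcont (g : R -> R) x :=
  forall eps, 0 < eps -> exists2 d, 0 < d & forall y, x < y < x + d -> g y < g x + eps.

(** Otherwise [g] jumps to the right of every point. Its values beyond [x0] then come arbitrarily
    close to their infimum from above, yet fill no interval there, as each is followed by a gap; the
    germ at the infimum allows neither. *)
Lemma incr_rcont g a b : DefT1 g -> incr_on g a b -> a < b ->
  exists2 x, a < x < b & rcont g x.
Proof.
move=> dg mg ab; apply: contrapT => nrc.
have jump x : a < x < b -> exists2 t, 0 < t & forall y, x < y < b -> g x + t <= g y.
  move=> hx; apply: contrapT => nj; apply: nrc; exists x => // t t0.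
  apply: contrapT => nd; apply: nj; exists t => // y hy.
  apply: contrapT => ny; apply: nd; exists (y - x); first by lra.
  by move=> z hz; have := mg z y ltac:(lra) ltac:(lra) ltac:(lra); lra.
(* Starting at an interior point bounds the values below by [g x0]. *)
pose x0 := (a + b) / 2.
have hx0 : a < x0 < b by rewrite /x0; lra.
move: x0 hx0 => x0 hx0.
pose S u := exists x, x0 < x < b /\ u = g x.
have dS : Def1 S by rewrite /Def1 /S; definability.
have [||s [s1 s2]] := ex_inf S (g x0) dS.
- by exists (g ((x0 + b) / 2)), ((x0 + b) / 2); split=> //; lra.
- by move=> _ [x [? ->]]; apply: mg; lra.
have [d sd [hd|hd]] := germ_right _ s dS; have [_ [x [hx ->]] gd] := s2 _ sd.
  have [t t0 ht] := jump x ltac:(lra).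
  have sg : s <= g x by apply: s1; exists x.
  have [u [? ?]] : exists u, g x < u < d /\ u < g x + t.
    have [?|?] := leP d (g x + t); [exists ((g x + d) / 2)|exists (g x + t / 2)]; lra.
  have [z [hz uz]] := hd u ltac:(lra).
  have [xz|zx|E] := ltgtP x z.
  - by have := ht z ltac:(lra); lra.
  - by have := mg z x ltac:(lra) zx ltac:(lra); lra.
  - by move: uz; rewrite -E; lra.
have [t t0 /(_ x) ht] := jump ((x0 + x) / 2) ltac:(lra).
have := s1 (g ((x0 + x) / 2)) ltac:(exists ((x0 + x) / 2); split=> //; lra).
move=> ?; apply: (hd (g x)); last by exists x.
by have := ht ltac:(lra); lra.
Qed.

Definition cont1 (g : R -> R) x :=
  forall eps, 0 < eps -> exists2 d, 0 < d & forall y, `|y - x| < d -> `|g y - g x| < eps.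

(** Right continuity cannot fail on a whole interval, so it holds on all of some [(a, c)]; the
    reflection [- g (- x)] then gives a left continuous point in [(a, c)]. *)
Lemma incr_cont g a b : DefT1 g -> incr_on g a b -> a < b ->
  exists2 x, a < x < b & cont1 g x.
Proof.
move=> dg mg ab.
have dr : Def1 (rcont g).
  pose r x := forall eps, 0 < eps -> exists d, 0 < d /\ forall y, x < y < x + d -> g y < g x + eps.
  have E : rcont g = r.
    apply/funext => x; apply/propext.
    by split=> h eps /h; [case=> d ? ?; exists d|case=> d [? ?]; exists d].
  by rewrite E /Def1 /r; definability.
have [c /andP[ac cb] [hc|hc]] := germ_interval _ _ _ dr ab; last first.
  have [x y ax xy yc|x xac rx] := incr_rcont g a c dg _ ac; last by case: (hc x).
  by apply: mg => //; lra.
pose h x := - g (- x).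
have dh : DefT1 h by rewrite /DefT1 /h; definability.
have [||x hx lx] := incr_rcont h (- c) (- a) dh; last 1 first.
- exists (- x); first by lra.
  move=> eps eps0; have [d1 d10 h1] := lx _ eps0.
  have [d2 d20 h2] := hc (- x) ltac:(lra) _ eps0.
  have [d [d0 [? ?]]] : exists d, 0 < d /\ d <= d1 /\ d <= d2 /\ d <= - x - a /\ d <= b + x.
    exists (Num.min (Num.min d1 d2) (Num.min (- x - a) (b + x))).
    by rewrite !lt_min !ge_min !lexx ?orbT; split=> //; lra.
  exists d => // y; rewrite ltr_norml => hy; rewrite ltr_norml.
  have [xy|yx|->] := ltgtP (- x) y; last by lra.
    have := h2 y ltac:(lra); have := mg (- x) y ltac:(lra) xy ltac:(lra); lra.
  have := h1 (- y) ltac:(lra); rewrite /h opprK.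
  have := mg y (- x) ltac:(lra) yx ltac:(lra); lra.
- move=> u v ? ? ?; rewrite /h lerN2; apply: mg; lra.
- lra.
Qed.

Lemma cont_point1 g a b : DefT1 g -> a < b -> exists2 x, a < x < b & cont1 g x.
Proof.
move=> dg ab; have [a' [b' [? a'b' ? [mg|mg]]]] := monotone_subinterval _ _ _ dg ab.
  by have [x ? ?] := incr_cont _ _ _ dg mg a'b'; exists x => //; lra.
have dng : DefT1 (fun x => - g x) by rewrite /DefT1; definability.
have [x ? cx] := incr_cont _ _ _ dng mg a'b'; exists x; first by lra.
move=> eps /cx [d d0 hd]; exists d => // y /hd.
by rewrite -opprD normrN.
Qed.

(** * Definable choice *)

Lemma DefT_choose (Q : (nat -> R) -> R -> Prop) : DefR Q ->
  (forall e y z, Q e y -> Q e z -> y = z) ->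
  exists2 t, DefT t & forall e, (exists y, Q e y) -> Q e (t e).
Proof.
move=> dQ Q1.
pose t e := if pselect (exists y, Q e y) is left h then projT1 (cid h) else 0.
have tQ e : (exists y, Q e y) -> Q e (t e).
  by move=> h; rewrite /t; case: pselect => // h'; exact: projT2 (cid h').
exists t => //.
apply: (DefT_graph _ (fun e y => Q e y \/ (~ (exists z, Q e z) /\ y = 0))); last by definability.
move=> e y; split=> [->|[Qy|[nQ ->]]].
- have [/tQ|nQ] := EM (exists y, Q e y); [by left|right].
  by split=> //; rewrite /t; case: pselect.
- by apply: (Q1 _ _ _ Qy); apply: tQ; exists y.
- by rewrite /t; case: pselect.
Qed.

Lemma definable_inf (Q : (nat -> R) -> R -> Prop) : DefR Q ->
  exists2 t, DefT t & forall e m, (exists y, Q e y) -> (forall y, Q e y -> m <= y) -> is_inf (Q e) (t e).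
Proof.
move=> dQ; have [||t dt ht] := DefT_choose (fun e => is_inf (Q e)).
- by rewrite /DefR /is_inf; definability.
- by move=> e; exact: is_inf_uniq.
- exists t => // e m Qe hm; apply: ht; apply: ex_inf Qe hm.
  by rewrite /Def1; definability.
Qed.

(** The choice is the infimum if it lies in [Q], and otherwise the midpoint of the first interval of
    [Q], which starts at the infimum. *)
Lemma definable_choice_pos (Q : (nat -> R) -> R -> Prop) : DefR Q ->
  (forall e y, Q e y -> 0 < y) ->
  exists2 t, DefT t & forall e, (exists y, Q e y) -> Q e (t e).
Proof.
move=> dQ Qpos; have [i di hi] := definable_inf _ dQ.
(* [j] is where this first interval ends; the cutoff at [i e + 1] keeps [E] nonempty when [Q] never
   ends. *)
pose E e z := i e < z /\ (~ Q e z \/ i e + 1 <= z).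
have dE : DefR E by rewrite /DefR /E; definability.
have [j dj hj] := definable_inf _ dE.
exists (fun e => if `[< Q e (i e) >] then i e else (i e + j e) / 2).
  by apply: DefT_if; definability.
move=> e Qe; case: asboolP => // Qi.
have [i1 i2] := hi e 0 Qe ltac:(by move=> y /Qpos /ltW).
have [j1 j2] : is_inf (E e) (j e).
  by apply: (hj e (i e)) => [|y []]; [exists (i e + 1); split; [|right]|]; lra.
have [d id [hd|hd]] : exists2 b, i e < b &
    (forall x, i e < x < b -> Q e x) \/ (forall x, i e < x < b -> ~ Q e x).
  by apply: germ_right; rewrite /Def1; definability.
  have ij : i e < j e.
    rewrite ltNge; apply/negP => ji.
    have [z [iz [nQ|?]] zd] := j2 (Num.min d (i e + 1)) ltac:(rewrite lt_min; lra).
      by apply: nQ; apply: hd; rewrite iz; move: zd; rewrite lt_min; lra.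
    by move: zd; rewrite lt_min; lra.
  apply: contrapT => nQ.
  have /j1 : E e ((i e + j e) / 2) by split; [lra|left].
  by lra.
have [x Qx xd] := i2 _ id; case: (hd x) => //; rewrite xd andbT lt_neqAle i1 // andbT.
by apply/negP => /eqP h; apply: Qi; rewrite h.
Qed.

Lemma definable_choice (Q : (nat -> R) -> R -> Prop) : DefR Q ->
  exists2 t, DefT t & forall e, (exists y, Q e y) -> Q e (t e).
Proof.
move=> dQ.
have [||t1 dt1 h1] := definable_choice_pos (fun e y => 0 < y /\ Q e y); try by move=> e y [].
  by rewrite /DefR; definability.
have [||t2 dt2 h2] := definable_choice_pos (fun e y => 0 < y /\ Q e (- y)); try by move=> e y [].
  by rewrite /DefR; definability.
exists (fun e => if `[< Q e 0 >] then 0 else if `[< Q e (t1 e) >] then t1 e else - t2 e).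
  by apply: DefT_if; [definability|definability|apply: DefT_if; definability].
move=> e [y Qy]; case: asboolP => // Q0; case: asboolP => // Q1.
have [y0|y0|E] := ltgtP y 0; last by rewrite E in Qy.
  by have [] : 0 < t2 e /\ Q e (- t2 e) by apply: h2; exists (- y); rewrite opprK; split=> //; lra.
by case: Q1; have [] : 0 < t1 e /\ Q e (t1 e) by apply: h1; exists y.
Qed.

Definition prepend n (u e : nat -> R) : nat -> R := fun i => if (i < n)%N then u i else e (i - n)%N.

Lemma definable_choices n (P : (nat -> R) -> Prop) : Def P ->
  exists2 z : nat -> (nat -> R) -> R, (forall i, DefT (z i)) &
    forall e, (exists u, P (prepend n u e)) -> P (prepend n (fun i => z i e) e).
Proof.
elim: n P => [|n IH] P dP.
  exists (fun _ _ => 0) => [i|e [u]]; first by definability.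
  by congr P; apply/funext.
have dQ : DefR (fun e y => P (scons y e)).
  apply: Def_subst dP _ => -[|i]; definability.
have [z dz hz] := IH _ (Def_ex _ dQ).
have [t dt ht] := definable_choice _ dQ.
pose s e := prepend n (fun i => z i e) e.
exists (fun i e => if i is j.+1 then z j e else t (s e)).
  case=> [|j]; last exact: dz.
  apply: (DefT_subst _ s dt) => i; rewrite /s /prepend; case: (i < n)%N; [exact: dz|definability].
have E u e : prepend n.+1 u e = scons (u 0%N) (prepend n (shift u) e).
  by apply/funext => -[|i].
move=> e [u]; rewrite !E => Pu.
by apply: ht; apply: hz; exists (shift u), (u 0%N).
Qed.

(** * Generic continuity on boxes *)

Lemma cube_refl n c r : 0 < r -> cube n c r c.
Proof. by move=> r0 i; split=> // _; rewrite subrr normr0. Qed.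

Lemma cube_le n c r s e : r <= s -> cube n c r e -> cube n c s e.
Proof. by move=> rs be i; split=> [/(be i).1|/(be i).2 //]; move=> /lt_le_trans; apply. Qed.

Lemma uniform_pos n (P : nat -> R -> Prop) :
  (forall i s t, (i < n)%N -> P i t -> 0 < s <= t -> P i s) ->
  (forall i, (i < n)%N -> exists2 t, 0 < t & P i t) ->
  exists2 t, 0 < t & forall i, (i < n)%N -> P i t.
Proof.
elim: n => [|n IH] mono hP; first by exists 1.
have [||s s0 hs] := IH; [by move=> i a b ?; apply: mono; lia|by move=> i ?; apply: hP; lia|].
have [t t0 ht] := hP n (ltnSn n).
exists (Num.min s t) => [|i]; first by rewrite lt_min s0.
rewrite ltnS leq_eqVlt => /orP[/eqP ->|lti].
  by apply: mono ht _; rewrite // lt_min s0 t0 ge_min lexx orbT.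
by apply: mono (hs _ lti) _; [lia|rewrite lt_min s0 t0 ge_min lexx].
Qed.

Lemma cube_open n c r e : cube n c r e ->
  exists2 d, 0 < d & forall e', cube n e d e' -> cube n c r e'.
Proof.
move=> be; have [||d d0 hd] := uniform_pos n (fun i d => `|e i - c i| + d <= r).
- by move=> i s t _; lra.
- by move=> i /(be i).1 ?; exists (r - `|e i - c i|); lra.
- exists d => // e' be' i; split=> lti; last by rewrite (be' i).2 // (be i).2.
  rewrite -(subrKA (e i)) (le_lt_trans (ler_normD _ _)) //.
  by have := hd _ lti; have := (be' i).1 lti; lra.
Qed.

Definition cont_at n (f : (nat -> R) -> R) e :=
  forall eps, 0 < eps -> exists2 d, 0 < d & forall e', cube n e d e' -> `|f e' - f e| < eps.

Lemma Def_cont n f : DefT f -> Def (cont_at n f).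
Proof. by move=> df; rewrite /cont_at; definability. Qed.

Definition dichotomy n := forall P c r, Def P -> 0 < r ->
  exists c' r', [/\ 0 < r', forall e, cube n c' r' e -> cube n c r e &
    (forall e, cube n c' r' e -> P e) \/ (forall e, cube n c' r' e -> ~ P e)].

Definition generic_cont n := forall f c r, DefT f -> 0 < r -> exists2 e, cube n c r e & cont_at n f e.

Lemma dense_subbox n P c r : dichotomy n -> Def P -> 0 < r ->
  (forall c' r', 0 < r' -> (forall e, cube n c' r' e -> cube n c r e) ->
    exists2 e, cube n c' r' e & P e) ->
  exists c' r', [/\ 0 < r', forall e, cube n c' r' e -> cube n c r e &
    forall e, cube n c' r' e -> P e].
Proof.
move=> An dP r0 hP; have [c' [r' [r'0 sub [h|h]]]] := An _ c r dP r0; first by exists c', r'.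
by have [e /h] := hP _ _ r'0 sub.
Qed.

(** The continuity points of each function are dense and definable, so they contain a subcube; [N]
    successive shrinkings serve all functions. *)
Lemma common_cont n N (f : nat -> (nat -> R) -> R) c r : dichotomy n -> generic_cont n ->
  (forall i, DefT (f i)) -> 0 < r ->
  exists2 e, cube n c r e & forall i, (i < N)%N -> cont_at n (f i) e.
Proof.
move=> An Cn df r0.
suff [c' [r' [r'0 sub h]]] : exists c' r', [/\ 0 < r', forall e, cube n c' r' e -> cube n c r e &
    forall e, cube n c' r' e -> forall i, (i < N)%N -> cont_at n (f i) e].
  by exists c'; [apply: sub|apply: h]; exact: cube_refl.
elim: N => [|N [c1 [r1 [r10 sub1 h1]]]]; first by exists c, r.
have [|c2 r2 r20 _|c2 [r2 [r20 sub2 h2]]] := dense_subbox n (cont_at n (f N)) c1 r1 An _ r10.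
- exact: Def_cont.
- exact: Cn.
- exists c2, r2; split=> // [e /sub2/sub1//|e be i].
  by rewrite ltnS leq_eqVlt => /orP[/eqP ->|]; [exact: h2|apply: h1; exact: sub2].
Qed.

(** A pigeonhole for boxes; it will select one chart of the group over a whole box. *)
Lemma finite_cover n N (P : nat -> (nat -> R) -> Prop) c r : dichotomy n ->
  (forall i, Def (P i)) -> 0 < r ->
  (forall e, cube n c r e -> exists2 i, (i < N)%N & P i e) ->
  exists i c' r', [/\ (i < N)%N, 0 < r', forall e, cube n c' r' e -> cube n c r e &
    forall e, cube n c' r' e -> P i e].
Proof.
move=> An dP; elim: N c r => [|N IH] c r r0 hc; first by have [] := hc c (cube_refl _ _ _ r0).
have [c1 [r1 [r10 sub1 [h1|h1]]]] := An _ c r (dP N) r0; first by exists N, c1, r1.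
have [e be|i [c2 [r2 [? ? sub2 ?]]]] := IH c1 r1 r10.
  have [i] := hc e (sub1 _ be); rewrite ltnS leq_eqVlt => /orP[/eqP ->|lti]; first by move/(h1 _ be).
  by exists i.
by exists i, c2, r2; split=> // [|e /sub2/sub1//]; lia.
Qed.

(** Selecting the intervals definably and evaluating at a common point of
    continuity of their centers and radii makes the interval independent of the
    point of a smaller box. *)
Lemma uniform_interval n (Psi : (nat -> R) -> R -> R -> Prop) c r :
  dichotomy n -> generic_cont n -> DefR2 Psi -> 0 < r ->
  (forall e y y' t t', Psi e y t -> `|y' - y| + t' <= t -> Psi e y' t') ->
  (forall e, cube n c r e -> exists y t, 0 < t /\ Psi e y t) ->
  exists c' r' y t, [/\ 0 < r', 0 < t, forall e, cube n c' r' e -> cube n c r e &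
    forall e, cube n c' r' e -> Psi e y t].
Proof.
move=> An Cn dPsi r0 mono hPsi.
pose P e := 0 < e 1%N /\ Psi (fun i => e i.+2) (e 0%N) (e 1%N).
have dP : Def P by rewrite /P; definability.
have [z dz hz] := definable_choices 2 P dP.
have Pz e : cube n c r e -> 0 < z 1%N e /\ Psi e (z 0%N e) (z 1%N e).
  move=> /hPsi [y [t [t0 Pyt]]]; have := hz e; rewrite /P /prepend /=.
  have -> : (fun i => e (i.+2 - 2)%N) = e by apply/funext => i; rewrite subn2.
  by apply; exists (fun i => if i is 0%N then y else t).
have [e be ce] := common_cont n 2 z c r An Cn dz r0.
have [t0 _] := Pz _ be; set t := z 1%N e in t0.
(* Center and radius move by less than [t / 8], so the interval of radius [t / 2] still fits:
   [t / 8 + t / 2 <= t - t / 8]. *)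
have [d0 d00 h0] := ce 0%N isT (t / 8) ltac:(lra).
have [d1 d10 h1] := ce 1%N isT (t / 8) ltac:(lra).
have [d2 d20 h2] := cube_open _ _ _ _ be.
exists e, (Num.min d2 (Num.min d0 d1)), (z 0%N e), (t / 2); split.
- by rewrite !lt_min; lra.
- lra.
- by move=> e' /(cube_le _ _ _ d2) be'; apply/h2/be'; rewrite ge_min lexx.
- move=> e' be'.
  have [_ Pe'] : 0 < z 1%N e' /\ Psi e' (z 0%N e') (z 1%N e').
    by apply/Pz/h2; apply: cube_le be'; rewrite ge_min lexx.
  apply: mono Pe' _; rewrite distrC.
  have : `|z 0%N e' - z 0%N e| < t / 8 by apply: h0; apply: cube_le be'; rewrite !ge_min lexx ?orbT.
  have : `|z 1%N e' - t| < t / 8 by apply: h1; apply: cube_le be'; rewrite !ge_min lexx ?orbT.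
  by rewrite ltr_norml; lra.
Qed.

Lemma cube_upd n c r e y : cube n c r e -> `|y - c n| < r -> cube n.+1 c r (upd e n y).
Proof.
move=> be hy i; split=> lti; rewrite /upd; case: eqVneq => [E|ni]; rewrite ?E //; try lia.
- by apply: (be i).1; lia.
- by apply: (be i).2; lia.
Qed.

Lemma upd_id e n : upd e n (e n) = e.
Proof. by apply/funext => i; rewrite /upd; case: eqP => [->|]. Qed.

Lemma upd_upd e n y z : upd (upd e n y) n z = upd e n z.
Proof. by apply/funext => i; rewrite /upd; case: eqP. Qed.

(** An [n]-cube treats variable [n] as a parameter fixed by its center, hence the reset
    [upd e n (c n)] to compare a point with its base. *)
Lemma cube_product n c r c' r' y t : 0 < r' -> 0 < t ->
  (forall e, cube n c' r' e -> cube n c r e) -> (forall z, `|z - y| < t -> `|z - c n| < r) ->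
  exists c2 r2, [/\ 0 < r2, forall e, cube n.+1 c2 r2 e -> cube n.+1 c r e &
   forall e, cube n.+1 c2 r2 e -> cube n c' r' (upd e n (c n)) /\ `|e n - y| < t].
Proof.
move=> r'0 t0 sub subv.
pose c2 := upd c' n y; pose r2 := Num.min r' t.
have c'n : c' n = c n by apply: (sub c' _ n).2 => //; exact: cube_refl.
have key e : cube n.+1 c2 r2 e -> cube n c' r' (upd e n (c n)) /\ `|e n - y| < t.
  move=> be; split; last first.
    have := (be n).1 (ltnSn n); rewrite /c2 /upd eqxx => /lt_le_trans; apply.
    by rewrite ge_min lexx orbT.
  move=> i; split=> lti; rewrite /upd; case: eqVneq => [E|ni]; rewrite ?E ?c'n ?subrr ?normr0 //.
    have := (be i).1 (ltnW lti); rewrite /c2 /upd (negPf ni) => /lt_le_trans; apply.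
    by rewrite ge_min lexx.
  by have := (be i).2 ltac:(lia); rewrite /c2 /upd (negPf ni).
exists c2, r2; split=> // [|e /key [/sub be /subv he]]; first by rewrite lt_min r'0.
by have := cube_upd _ _ _ _ _ be he; rewrite upd_upd upd_id.
Qed.

(** The dichotomy in [n] variables is applied to the base points whose slice contains an interval of
    [P]. If these fill a box, [finish] yields a cube in [P]; if they miss one, every slice over it
    contains an interval of the complement. *)
Lemma dichotomyS n : dichotomy n -> generic_cont n -> dichotomy n.+1.
Proof.
move=> An Cn P c r dP r0.
pose Psi (Q : (nat -> R) -> Prop) e y t := forall z, y - t < z < y + t ->
  `|z - c n| < r /\ Q (upd e n z).
have dPsi Q : Def Q -> DefR2 (Psi Q) by move=> dQ; rewrite /DefR2 /Psi; definability.
have mono Q e y y' t t' : Psi Q e y t -> `|y' - y| + t' <= t -> Psi Q e y' t'.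
  move=> h ht z hz; apply: h; have := ler_norm (y' - y); have := ler_norm (- (y' - y)).
  by rewrite normrN; lra.
have finish Q c1 r1 : Def Q -> 0 < r1 -> (forall e, cube n c1 r1 e -> cube n c r e) ->
    (forall e, cube n c1 r1 e -> exists y t, 0 < t /\ Psi Q e y t) ->
    exists c' r', [/\ 0 < r', forall e, cube n.+1 c' r' e -> cube n.+1 c r e &
    forall e, cube n.+1 c' r' e -> Q e].
  move=> dQ r10 sub1 hQ.
  have [c2 [r2 [y [t [r20 t0 sub2 h2]]]]] := uniform_interval _ _ _ _ An Cn (dPsi _ dQ) r10 (mono Q) hQ.
  have [|z hz|c3 [r3 [r30 sub3 h3]]] := cube_product n c r c2 r2 y t r20 t0.
  - by move=> e /sub2/sub1.
  - have [||//] := h2 c2 _ z; first exact: cube_refl.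
    by move: hz; rewrite ltr_norml; lra.
  - exists c3, r3; split=> // e be; have [be2 he] := h3 _ be.
    have := h2 _ be2 (e n); rewrite upd_upd upd_id => -[|//].
    by move: he; rewrite ltr_norml; lra.
pose A e := exists y t, 0 < t /\ Psi P e y t.
have dA : Def A by have dPP := dPsi P dP; rewrite /A; definability.
have [c1 [r1 [r10 sub1 [h1|h1]]]] := An _ c r dA r0.
  by have [c' [r' [? ? ?]]] := finish _ _ _ dP r10 sub1 h1; exists c', r'; split=> //; left.
have [|c' [r' [? ? ?]]] := finish _ _ _ (Def_not _ dP) r10 sub1; last by exists c', r'; split=> //; right.
move=> e be; have dl : Def1 (fun z => P (upd e n z)) by rewrite /Def1; definability.
have [b /andP[ab br] [hb|hb]] := germ_interval _ (c n - r) (c n + r) dl ltac:(lra).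
  case: (h1 e be); exists ((c n - r + b) / 2), ((b - c n + r) / 2); split=> [|z hz]; first by lra.
  by split; [rewrite ltr_norml|apply: hb]; lra.
exists ((c n - r + b) / 2), ((b - c n + r) / 2); split=> [|z hz]; first by lra.
by split; [rewrite ltr_norml|apply: hb]; lra.
Qed.

Lemma cube_upd_center n e d y : 0 < d -> forall e', cube n.+1 e d e' -> cube n (upd e n y) d (upd e' n y).
Proof.
move=> d0 e' be i; split=> lti; rewrite /upd; case: eqVneq => [E|ni]; rewrite ?subrr ?normr0 //.
  by apply: (be i).1; lia.
by apply: (be i).2; lia.
Qed.

Lemma norm_between (a b c d x f0 eps : R) : `|a - c| < eps / 2 -> `|c - f0| < eps / 2 ->
  `|b - d| < eps / 2 -> `|d - f0| < eps / 2 -> a <= x <= b \/ b <= x <= a -> `|x - f0| < eps.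
Proof. by rewrite !ltr_norml => ? ? ? ? [] ?; lra. Qed.

(** A function that is monotone in the last variable and continuous in the
    others is squeezed between its values on two horizontal slices. *)
Lemma generic_contS n : dichotomy n -> generic_cont n -> dichotomy n.+1 -> generic_cont n.+1.
Proof.
move=> An Cn An1 f c r df r0.
pose Psi e y t := (forall z, y - t < z < y + t -> `|z - c n| < r) /\
  ((forall z1, y - t < z1 -> forall z2, z1 < z2 -> z2 < y + t -> f (upd e n z1) <= f (upd e n z2)) \/
   (forall z1, y - t < z1 -> forall z2, z1 < z2 -> z2 < y + t -> - f (upd e n z1) <= - f (upd e n z2))).
have dPsi : DefR2 Psi by rewrite /DefR2 /Psi; definability.
have mono e y y' t t' : Psi e y t -> `|y' - y| + t' <= t -> Psi e y' t'.
  move=> [h1 h2] ht; have := ler_norm (y' - y); have := ler_norm (- (y' - y)).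
  rewrite normrN => l1 l2; split=> [z hz|]; first by apply: h1; lra.
  by case: h2 => h2; [left|right] => z1 ? z2 ? ?; apply: h2; lra.
have [|c1 [r1 [y [t [r10 t0 sub1 h1]]]]] := uniform_interval n Psi c r An Cn dPsi r0 mono.
  move=> e be; have dg : DefT1 (fun z => f (upd e n z)) by rewrite /DefT1; definability.
  have [a [b [ca ab bc hab]]] := monotone_subinterval _ (c n - r) (c n + r) dg ltac:(lra).
  exists ((a + b) / 2), ((b - a) / 2); split; first by lra.
  rewrite /Psi; have -> : (a + b) / 2 - (b - a) / 2 = a by lra.
  have -> : (a + b) / 2 + (b - a) / 2 = b by lra.
  split=> [z hz|]; first by rewrite ltr_norml; lra.
  by case: hab => hab; [left|right] => z1 ? z2 ? ?; apply: hab.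
have [z hz|c2 [r2 [r20 sub2 h2]]] := cube_product n c r c1 r1 y t r10 t0 sub1.
  have [+ _] := h1 _ (cube_refl _ _ _ r10); apply.
  by move: hz; rewrite ltr_norml; lra.
(* Continuity in the first [n] variables is dense, by [generic_cont n] on the horizontal slice
   through the center of each cube; so it holds on a whole cube. *)
have [|c' r' r'0 _|c3 [r3 [r30 sub3 h3]]] := dense_subbox _ (cont_at n f) c2 r2 An1 _ r20.
- exact: Def_cont.
- have [e be ce] := Cn f c' r' df r'0; exists e => // i; split=> lti; last by apply: (be i).2; lia.
  move: lti; rewrite ltnS leq_eqVlt => /orP[/eqP ->|/(be i).1//].
  by rewrite (be n).2 // subrr normr0.
have dg : DefT1 (fun z => f (upd c3 n z)) by rewrite /DefT1; definability.
have [z0 hz0 cz0] := cont_point1 _ (c3 n - r3) (c3 n + r3) dg ltac:(lra).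
have inbox z : c3 n - r3 < z < c3 n + r3 -> cube n.+1 c3 r3 (upd c3 n z).
  by move=> hz; apply: cube_upd; [exact: cube_refl|rewrite ltr_norml; lra].
exists (upd c3 n z0); first exact/sub2/sub3/inbox.
move=> eps eps0; have [d1 d10 hd1] := cz0 (eps / 2) ltac:(lra).
(* The squeezing slices are at heights [z0 - d] and [z0 + d]: both inside the cube, and close enough
   that [f] on the vertical line changes by less than [eps / 2]. *)
have [d [d0 [dd1 [dl dr]]]] : exists d, 0 < d /\ d < d1 /\ c3 n - r3 < z0 - d /\ z0 + d < c3 n + r3.
  exists (Num.min d1 (Num.min (z0 - c3 n + r3) (c3 n + r3 - z0)) / 2).
  set m := Num.min _ _.
  have [m0 [m1 [m2 m3]]] : 0 < m /\ m <= d1 /\ m <= z0 - c3 n + r3 /\ m <= c3 n + r3 - z0.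
    by rewrite /m !lt_min !ge_min !lexx ?orbT; split=> //; lra.
  by clearbody m; lra.
have [dm dm0 hdm] := h3 _ (inbox (z0 - d) ltac:(lra)) (eps / 2) ltac:(lra).
have [dp dp0 hdp] := h3 _ (inbox (z0 + d) ltac:(lra)) (eps / 2) ltac:(lra).
have [d4 d40 hd4] := cube_open _ _ _ _ (inbox z0 hz0).
pose m := Num.min (Num.min d d4) (Num.min dm dp).
have [m0 [md [m4 [mdm mdp]]]] : 0 < m /\ m <= d /\ m <= d4 /\ m <= dm /\ m <= dp.
  by rewrite /m !lt_min !ge_min !lexx ?orbT; split=> //; lra.
exists m => // e be; clearbody m.
have be3 : cube n.+1 c3 r3 e by apply/hd4/(cube_le _ _ _ _ _ m4).
have slice z : cube n (upd c3 n z) m (upd e n z).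
  by have := cube_upd_center _ _ _ z m0 _ be; rewrite upd_upd.
have en : z0 - m < e n < z0 + m.
  by have := (be n).1 (ltnSn n); rewrite /upd eqxx ltr_norml; lra.
have [cl cr] : y - t < z0 - d /\ z0 + d < y + t.
  have rng z : c3 n - r3 < z < c3 n + r3 -> y - t < z < y + t.
    move=> hz; have [_] := h2 _ (sub3 _ (inbox z hz)).
    by rewrite /upd eqxx ltr_norml; lra.
  by have /andP[] := rng (z0 - d) ltac:(lra); have /andP[] := rng (z0 + d) ltac:(lra).
have [be1 _] := h2 _ (sub3 _ be3); have [_ hm] := h1 _ be1.
have [el er] : z0 - d < e n /\ e n < z0 + d by lra.
have hd1m : `|f (upd c3 n (z0 - d)) - f (upd c3 n z0)| < eps / 2.
  by apply: hd1; rewrite addrC addKr normrN gtr0_norm.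
have hd1p : `|f (upd c3 n (z0 + d)) - f (upd c3 n z0)| < eps / 2.
  by apply: hd1; rewrite addrC addKr gtr0_norm.
apply: (norm_between _ _ _ _ _ _ _ (hdm _ (cube_le _ _ _ _ _ mdm (slice _))) hd1m
  (hdp _ (cube_le _ _ _ _ _ mdp (slice _))) hd1p).
case: hm => hm; [left|right]; have := hm (z0 - d) cl (e n) el (lt_trans er cr);
  have := hm (e n) (lt_trans cl el) (z0 + d) er cr; rewrite !upd_upd upd_id ?lerN2 => ? ?;
  exact/andP.
Qed.

Lemma dichotomy_cont n : dichotomy n /\ generic_cont n.
Proof.
elim: n => [|n [An Cn]]; last first.
  have An1 := dichotomyS n An Cn; split=> //; exact: generic_contS.
have B0 c r e : cube 0 c r e -> e = c by move=> be; apply/funext => i; apply: (be i).2.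
split=> [P c r dP r0|f c r df r0].
  exists c, r; split=> //; have [Pc|nPc] := EM (P c); [left|right] => e /B0 -> //.
exists c; first exact: cube_refl.
by move=> eps eps0; exists 1 => // e /B0 ->; rewrite subrr normr0.
Qed.

(** * The orbit map *)

Lemma Def_exV n (P : (nat -> R) -> 'rV[R]_n -> Prop) :
  Def (fun e => P (shiftn n e) (\row_i e i)) -> Def (fun e => exists x, P e x).
Proof.
move=> /(Def_exs n); apply: Def_ext => e.
have E u : P (shiftn n (prepend n u e)) (\row_i prepend n u e i) <-> P e (\row_i u i).
  have -> : shiftn n (prepend n u e) = e by apply/funext => i; rewrite /prepend ltnNge leq_addr addKn.
  by have -> : \row_(i < n) prepend n u e i = \row_i u i by apply/rowP => i; rewrite !mxE /prepend ltn_ord.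
split=> [[u /E]|[x Px]]; first by exists (\row_i u i).
exists (ext x); apply/E; move: Px; congr P.
by apply/rowP => i; rewrite mxE ext_ord.
Qed.

Lemma DefT_row_mx a b (X : (nat -> R) -> 'rV[R]_a) (Y : (nat -> R) -> 'rV[R]_b) :
  (forall i, DefT (fun e => X e 0 i)) -> (forall i, DefT (fun e => Y e 0 i)) ->
  forall i, DefT (fun e => row_mx (X e) (Y e) 0 i).
Proof. by move=> dX dY i; under eq_fun do rewrite mxE; case: (split i). Qed.

Lemma Def_graph a b (A : set 'rV[R]_a) (f : 'rV[R]_a -> 'rV[R]_b)
    (X : (nat -> R) -> 'rV[R]_a) (Y : (nat -> R) -> 'rV[R]_b) : def_fun D A f ->
  (forall i, DefT (fun e => X e 0 i)) -> (forall i, DefT (fun e => Y e 0 i)) ->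
  Def (fun e => A (X e) /\ f (X e) = Y e).
Proof.
move=> df dX dY; apply: Def_ext (Def_set _ _ _ df (DefT_row_mx _ _ _ _ dX dY)) => e /=.
split=> [[x [Ax /eq_row_mx [-> ->]]]//|[AX <-]]; by exists (X e).
Qed.

Lemma DefT_row n (s : nat -> nat) (i : 'I_n) : DefT (fun e => (\row_(l < n) e (s l)) 0 i).
Proof. by under eq_fun do rewrite mxE; exact: DefT_var. Qed.

Lemma eucl_open_box n (c : nat -> R) d :
  eucl_open [set x : 'rV[R]_n | forall l : 'I_n, `|x 0 l - c l| < d].
Proof.
move=> x /= hx.
have [||t t0 ht] := uniform_pos n (fun i t => `|ext x i - c i| + t <= d).
- by move=> i s t _; lra.
- move=> i lti; exists (d - `|ext x i - c i|); last by lra.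
  by have := hx (Ordinal lti); rewrite -ext_ord /= ; lra.
- exists t; split=> // y hy l; have := hy l; have := ht l (ltn_ord l); rewrite ext_ord.
  rewrite -[y 0 l - c l](subrKA (x 0 l)) => h1 h2.
  by rewrite (le_lt_trans (ler_normD _ _)) //; lra.
Qed.

Lemma eucl_openI n (A B : set 'rV[R]_n) : eucl_open A -> eucl_open B -> eucl_open (A `&` B).
Proof.
move=> oA oB x [/oA [a [a0 ha]] /oB [b [b0 hb]]].
exists (Num.min a b); split=> [|y hy]; first by rewrite lt_min a0.
by split; [apply: ha|apply: hb] => i; have := hy i; rewrite lt_min => /andP[].
Qed.

Lemma open_nbhds (T : Type) (V : set T) tau (S : set T) : is_topology V tau ->
  (forall x, S x -> exists O, [/\ tau O, O x & O `<=` S]) -> tau S.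
Proof.
move=> [_ _ _ _ tU] hS.
have -> : S = [set x | exists O, (tau O /\ O `<=` S) /\ O x].
  by apply/seteqP; split=> [x /hS [O [? ? ?]]|x [O [[_ +] Ox]]]; [exists O|exact].
by apply: tU => O [].
Qed.

Lemma continuous_slice a b c (X : set 'rV[R]_a) (Y : set 'rV[R]_b) tX tY (tZ : set (set 'rV[R]_c)) f x :
  is_topology Y tY ->
  continuous_on (prod_set X Y) (prod_top tX tY) tZ (fun p => f (lsubmx p) (rsubmx p)) ->
  X x -> continuous_on Y tY tZ (f x).
Proof.
move=> topY cf Xx O /cf oO; apply: (open_nbhds _ _ _ _ topY) => y [Yy Ofy].
have [|U [W [_ tW]]] := oO (row_mx x y).
  by rewrite /= /prod_set /= row_mxKl row_mxKr.
rewrite row_mxKl row_mxKr => Ux Wy sub; exists W; split=> // z Wz.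
have := sub (row_mx x z); rewrite /= /prod_set /= row_mxKl row_mxKr.
by move=> /(_ Ux Wz) [[_ ?] ?].
Qed.

Section Orbit.
Context {m k : nat} {G : set 'rV[R]_m} {V : set 'rV[R]_k}.
Context {alpha : 'rV[R]_m -> 'rV[R]_k -> 'rV[R]_k}.
Context {tauG : set (set 'rV[R]_m)} {tau : set (set 'rV[R]_k)} {dG n : nat}.
Hypothesis HmanG : definable_manifold D G tauG dG.
Hypothesis HmanV : definable_manifold D V tau n.
Hypothesis dalpha : def_fun D (prod_set G V) (fun p => alpha (lsubmx p) (rsubmx p)).

(** [h] is the value of a definable section of the orbit map at one of its
    points of continuity. *)
Lemma orbit_map_open_at v : V v -> (forall w, V w -> exists2 g, G g & alpha g v = w) ->
  exists2 h, G h & forall O, tauG O -> O h ->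
    exists T, [/\ tau T, T (alpha h v) & T `<=` [set alpha g v | g in O]].
Proof.
move=> Vv trans.
have [_ [_ [NV [U [psi [coverV chartV]]]]]] := HmanV.
have [_ [[_ _ _ tI _] [NG [W [phi [coverG chartG]]]]]] := HmanG.
have [j Uv] := (coverV v).1 Vv.
have [[tU dU] dpsi [opsi _] ipsi tpsi] := chartV j.
have [r [r0 hr]] := opsi _ (ex_intro2 _ _ v Uv erefl).
pose c := ext (psi j v).
(* The orbit relation in charts: variables below [dG] are the coordinates of [g], the next [n] those
   of its image [p]. *)
pose Gam i e := exists p g, (U j p /\ psi j p = \row_l e (dG + l)%N) /\
  (W i g /\ phi i g = \row_l e l) /\
  (prod_set G V (row_mx g v) /\ alpha (lsubmx (row_mx g v)) (rsubmx (row_mx g v)) = p).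
have dGam i : Def (Gam i).
  have [_ dphi _ _ _] := chartG i.
  apply: Def_exV; apply: Def_exV; apply: Def_and; last apply: Def_and.
  (* Under both quantifiers [g] occupies the first [m] variables and [p] the next [k], so those of
     [e] start at [m + k]. *)
  - apply: Def_graph dpsi _ _ => l; first exact: (DefT_row _ (fun l => m + l)%N).
    exact: (DefT_row _ (fun l => m + (k + (dG + l)))%N).
  - by apply: Def_graph dphi _ _ => l; [exact: (DefT_row _ id)|exact: (DefT_row _ (fun l => m + (k + l))%N)].
  - apply: Def_graph dalpha _ _ => [|l]; last exact: (DefT_row _ (fun l => m + l)%N).
    by apply: DefT_row_mx => l; [exact: (DefT_row _ id)|exact: DefT_const].
have [dn cn] := dichotomy_cont n.
pose P i e := if insub i is Some i' then exists u, Gam i' (prepend dG u e) else False.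
have dP i : Def (P i).
  by rewrite /P; case: insubP => [i' _ _|_]; [exact: Def_exs|exact: Def_true].
(* By transitivity every point of the box is reached from some chart of [G]; over a smaller box a
   single chart suffices, and the section can be chosen in its coordinates. *)
have [e be|i0 [c1 [r1 [lti r10 sub1 h1]]]] := finite_cover n NG P c r dn dP r0.
  have [p Up xp] : (psi j @` U j) (\row_l e l).
    by apply: hr => l; rewrite mxE -(ext_ord _ (psi j v)); apply: (be l).1.
  have [g Gg gp] := trans p ((coverV p).2 (ex_intro _ j Up)).
  have [i Wg] := (coverG g).1 Gg.
  exists i; rewrite // /P valK; exists (ext (phi i g)), p, g.
  split; first by split=> //; rewrite xp; apply/rowP => l; rewrite !mxE /prepend ltnNge leq_addr addKn.
  split; first by split=> //; apply/rowP => l; rewrite !mxE /prepend ltn_ord ext_ord.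
  by rewrite /prod_set /= row_mxKl row_mxKr.
pose i := Ordinal lti.
have {}h1 e : cube n c1 r1 e -> exists u, Gam i (prepend dG u e).
  by move=> /h1; rewrite /P -[i0]/(val i) valK.
have [z dz hz] := definable_choices dG (Gam i) (dGam i).
have [e0 be0 ce0] := common_cont n dG z c1 r1 dn cn dz r10.
have {}hz e : cube n c1 r1 e -> Gam i (prepend dG (fun l => z l e) e) by move=> /h1 /hz.
have rowz e : \row_(l < dG) prepend dG (fun l => z l e) e l = \row_l z l e.
  by apply/rowP => l; rewrite !mxE /prepend ltn_ord.
have rowx e : \row_(l < n) prepend dG (fun l => z l e) e (dG + l)%N = \row_l e l.
  by apply/rowP => l; rewrite !mxE /prepend ltnNge leq_addr addKn.
have [tW _ [ophi _] iphi tphi] := chartG i.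
have [p0 [h [[Up0 psip0] [[Wh phih] [[GVh _] hp0]]]]] := hz e0 be0.
move: GVh hp0 psip0 phih; rewrite /= row_mxKl row_mxKr rowz rowx => Gh hp0 psip0 phih.
exists h => // O tO Oh.
have [eps [eps0 heps]] : exists eps, 0 < eps /\ forall y : 'rV_dG,
    (forall l, `|y 0 l - (\row_l z l e0) 0 l| < eps) -> (phi i @` (O `&` W i)) y.
  have /tphi [oO _] : O `&` W i `<=` W i by move=> ? [].
  by apply: (oO (tI _ _ tO tW.1)); exists h.
have [||d1 d10 hd1] := uniform_pos dG (fun l d => forall e, cube n e0 d e -> `|z l e - z l e0| < eps).
- by move=> l s t _ ht st e be; apply/ht/(cube_le _ _ _ _ _ _ be); lra.
- by move=> l lti'; have [d ? ?] := ce0 _ lti' _ eps0; exists d.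
have [d2 d20 hd2] := cube_open _ _ _ _ be0.
pose d := Num.min d1 d2.
have [d0 [dd1 dd2]] : 0 < d /\ d <= d1 /\ d <= d2.
  by rewrite /d lt_min !ge_min !lexx orbT d10 d20.
pose B := [set x : 'rV[R]_n | forall l : 'I_n, `|x 0 l - e0 l| < d].
(* Over [B] the section stays within [eps] of the coordinates of [h], hence in the chart image of
   [O]. *)
pose T := U j `&` [set p | B (psi j p)].
have TU : T `<=` U j by move=> ? [].
exists T; split.
- apply/(tpsi _ TU).
  have -> : psi j @` T = (psi j @` U j) `&` B.
    apply/seteqP; split=> [_ [p [Up Bp] <-]|x [[p Up <-] Bp]]; first by split=> //; exists p.
    by exists p.
  by apply: eucl_openI => //; exact: eucl_open_box.
- by rewrite hp0; split=> //= l; rewrite psip0 mxE subrr normr0.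
- move=> p [Up Bp].
  (* Beyond [n] the environment must agree with [e0] to lie in the cube. *)
  pose e := splice n (ext (psi j p)) e0.
  have be : cube n e0 d e.
    move=> l; split=> ltl; rewrite /e /splice ?ltl ?ltnNge ?ltl //=.
    by rewrite -[l]/(val (Ordinal ltl)) ext_ord; exact: Bp.
  have [p' [g [[Up' psip'] [[Wg phig] [[GVg _] gp']]]]] := hz e (hd2 _ (cube_le _ _ _ _ _ dd2 be)).
  move: GVg gp' psip' phig; rewrite /= row_mxKl row_mxKr rowz rowx => Gg gp' psip' phig.
  have pp' : p' = p.
    apply: ipsi => //; rewrite psip'; apply/rowP => l.
    by rewrite mxE /e /splice ltn_ord ext_ord.
  have [|g' [Og' Wg'] E] := heps (phi i g).
    by move=> l; rewrite phig !mxE; apply: (hd1 l (ltn_ord l)); exact: cube_le be.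
  by exists g; rewrite -?pp' // (iphi g g').
Qed.
End Orbit.
End Definability.

(** * From openness at one point to openness everywhere *)

Theorem theorem4p4 (R : rcfType) (D : forall n, set (set 'rV[R]_n))
  (HD : ominimal_field_structure D)
  (m : nat) (G : set 'rV[R]_m) (mul : 'rV[R]_m -> 'rV[R]_m -> 'rV[R]_m)
  (e : 'rV[R]_m) (inv : 'rV[R]_m -> 'rV[R]_m)
  (HG : definable_group D G mul e inv)
  (tauG : set (set 'rV[R]_m)) (dG : nat)
  (HdG : has_dim G dG)
  (HtopG : topological_group G mul inv tauG)
  (HmanG : definable_manifold D G tauG dG)
  (k : nat) (V : set 'rV[R]_k) (HV : D k V)
  (alpha : 'rV[R]_m -> 'rV[R]_k -> 'rV[R]_k)
  (Halpha : definable_transitive_action D G mul e V alpha)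
  (tau : set (set 'rV[R]_k)) (n : nat)
  (HmanV : definable_manifold D V tau n)
  (Hcont : continuous_on (prod_set G V) (prod_top tauG tau) tau
             (fun p => alpha (lsubmx p) (rsubmx p)))
  (v : 'rV[R]_k) (Hv : V v) :
  forall O, tauG O -> tau [set alpha g v | g in O].
Proof.
have [_ Ge [Gmul Ginv] mulA mulK] := HG.
have [topG cmul _] := HtopG.
have [dalpha Valpha alpha1 alphaM trans] := Halpha.
have [_ [topV _]] := HmanV.
have [_ _ tauGV _ _] := topG.
have [h Gh open_h] := orbit_map_open_at HD HmanG HmanV dalpha v Hv (fun w => trans v w Hv).
move=> O tO; apply: (open_nbhds _ _ _ _ topV) => _ [g Og <-].
have Gg : G g := tauGV _ tO _ Og.
have Ggi := Ginv _ Gg; have Ghi := Ginv _ Gh.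
(* Left translation by [a] sends [h] to [g], and [b] is its inverse; [O] is pulled back along [a] to
   a neighbourhood of [h]. *)
pose a := mul g (inv h); pose b := mul h (inv g).
have Ga : G a by exact: Gmul.
have Gb : G b by exact: Gmul.
have [invg1 invg2] : mul (inv g) g = e /\ mul g (inv g) = e by have [] := mulK g Gg.
have [invh1 invh2] : mul (inv h) h = e /\ mul h (inv h) = e by have [] := mulK h Gh.
have [gE hE] : mul g e = g /\ mul h e = h by have [] := mulK g Gg; have [] := mulK h Gh.
have [eig] : mul e (inv g) = inv g by have [] := mulK _ Ggi.
have ah : mul a h = g by rewrite -mulA // invh1.
have bg : mul b g = h by rewrite -mulA // invg1.
have ab : mul a b = e.
  by rewrite /b mulA // ah.
have oN := continuous_slice _ _ _ _ _ _ _ _ _ _ topG cmul Ga O tO.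
have [|T [tT Th sub]] := open_h _ oN; first by rewrite /= ah.
(* This is the translate of [T] by [a], written as a preimage under [b] so that continuity of the
   action makes it open. *)
exists [set w | V w /\ T (alpha b w)]; split.
- exact: (continuous_slice _ _ _ _ _ _ _ _ _ _ topV Hcont Gb T tT).
- by split; [exact: Valpha|rewrite -alphaM // bg].
- move=> w [Vw /sub [x [Gx Oax] E]].
  exists (mul a x) => //.
  by rewrite alphaM // E -alphaM // ab alpha1.
Qed.
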